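(* Let $q$ be a power of a prime $p$, $K$ an algebraic closure of $\mathbb{F}_q$, and $\mathrm{AGL}(2,q)$ the stabilizer in $\mathrm{PGL}(3,q)$ of the line $Z=0$, acting on $\mathrm{PG}(2,K)$. Then $\varepsilon(\mathrm{AGL}(2,q))=q^2-q$.
   Context: Plane curves are projective plane curves over $K$; irreducible means the defining form is irreducible over $K$; a curve is $G$-invariant if every element of $G\le\mathrm{PGL}(3,K)$ maps it onto itself. $d(G)$ is the smallest degree of a $G$-invariant irreducible plane curve other than a line. $\varepsilon(G)$ is the first gap in the spectrum of degrees of $G$-invariant irreducible plane curves: $\varepsilon(G)=d'(G)-d(G)$, where $d'(G)$ is the smallest degree larger than $d(G)$ of a $G$-invariant irreducible plane curve. (Here $d(\mathrm{AGL}(2,q))=q^3-q^2$.) *)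

(* Defs.v *)
From mathcomp Require Import all_boot all_order all_algebra.
From mathcomp Require Import mpoly.
Set Implicit Arguments. Unset Strict Implicit. Unset Printing Implicit Defensive.
Import GRing.Theory.
Local Open Scope ring_scope.

(* Homogeneous polynomials in X, Y, Z are elements of {mpoly K[3]};
   variables 'X_0 = X, 'X_1 = Y, 'X_2 = Z.  Points of PG(2,K) are column
   vectors up to scalars; a 3x3 invertible matrix A acts by v |-> A v. *)

Definition pullback (K : fieldType) (A : 'M[K]_3) (F : {mpoly K[3]}) :
  {mpoly K[3]} :=
  F \mPo [tuple \sum_(j < 3) A i j *: 'X_j | i < 3].

Definition irreducible_mpoly (K : fieldType) (F : {mpoly K[3]}) : Prop :=
  (1 < msize F)%N /\
  forall G H : {mpoly K[3]}, F = G * H -> (msize G <= 1)%N \/ (msize H <= 1)%N.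

Definition irr_plane_curve (K : fieldType) (d : nat) (F : {mpoly K[3]}) : Prop :=
  F != 0 /\ F \is d.-homog /\ irreducible_mpoly F.

(* A collineation A (invertible matrix) maps the curve F = 0 onto itself
   iff F(A^{-1} v) is a scalar multiple of F, equivalently F(A v) = c F(v). *)
Definition curve_invariant (K : fieldType) (A : 'M[K]_3) (F : {mpoly K[3]}) :=
  exists2 c : K, c != 0 & pullback A F = c *: F.

(* G is given by a set of representing invertible matrices. *)
Definition G_invariant (K : fieldType) (G : 'M[K]_3 -> Prop) (F : {mpoly K[3]}) :=
  forall A, G A -> curve_invariant (invmx A) F.

Definition inv_degree (K : fieldType) (G : 'M[K]_3 -> Prop) (d : nat) : Prop :=
  exists F : {mpoly K[3]}, irr_plane_curve d F /\ G_invariant G F.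

(* d(G): smallest degree of a G-invariant irreducible curve other than a line
   (for an irreducible curve, being a line means having degree 1). *)
Definition is_dG (K : fieldType) (G : 'M[K]_3 -> Prop) (d : nat) : Prop :=
  (1 < d)%N /\ inv_degree G d /\
  forall e, (1 < e)%N -> inv_degree G e -> (d <= e)%N.

Definition is_epsilon (K : fieldType) (G : 'M[K]_3 -> Prop) (eps : nat) : Prop :=
  exists d d', is_dG G d /\
    (d < d')%N /\ inv_degree G d' /\
    (forall e, (d < e)%N -> inv_degree G e -> (d' <= e)%N) /\
    eps = (d' - d)%N.

Definition in_Fq (K : fieldType) (q : nat) (x : K) : bool := x ^+ q == x.

(* AGL(2,q): matrices with entries in F_q, invertible, stabilizing the line
   Z = 0, i.e. with third row (0, 0, a) (a != 0 by invertibility). *)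
Definition AGL2 (K : fieldType) (q : nat) (A : 'M[K]_3) : Prop :=
  (forall i j, in_Fq q (A i j)) /\ A \in unitmx /\
  A 2%:R 0 = 0 /\ A 2%:R 1 = 0.

(* Main.v *)
Require Import Defs.
From mathcomp Require Import all_boot all_order all_algebra.
From mathcomp Require Import mpoly.
From mathcomp Require Import all_field ring zify.
Set Implicit Arguments. Unset Strict Implicit. Unset Printing Implicit Defensive.
Import GRing.Theory.
Local Open Scope ring_scope.

(** Put U = X^q - X Z^(q-1), V = Y^q - Y Z^(q-1), and let
    L = U^q V - U V^q and D = (U^(q^2) V - U V^(q^2)) / L be the Dickson
    invariants in U, V, of degrees q^2+q and q^3-q^2.

    Lower bound.  Let F be an invariant form of degree e, irreducible and not
    linear.  Translations in X force F(X,1,Z) to be a polynomial in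
    X^q - X Z^(q-1), so f(x) = F(x,1,0) is a polynomial in x^q; invariance of f
    under x -> ax + b then makes it a polynomial in (x^(q^2) - x^q)^(q-1), and
    exchanging X and Y makes its coefficient sequence symmetric about e/2.
    Hence either e = k (q^3 - q^2), or x divides f and
    e >= (q^3 - q^2) + (q^2 - q).

    Existence.  The curves are D + Z^(q^3-q^2) and L^(q-1) + D Z^(q^2-q).  Each
    has an affine chart in which its equation is a polynomial over K[r] whose
    leading coefficient has a simple root r0, while all its nonconstant
    coefficients, but not the constant one, vanish at r0.  This is Eisenstein's
    criterion for the reversed polynomial (total ramification over r0).  *)

(** * Evaluation of forms, and factors of forms *)

Lemma rmorph_mmap (n : nat) (R : nzRingType) (S S' : comNzRingType)
    (f : {rmorphism R -> S}) (g : {rmorphism S -> S'}) (h : 'I_n -> S)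
    (p : {mpoly R[n]}) :
  g (mmap f h p) = mmap (g \o f) (g \o h) p.
Proof.
rewrite /mmap rmorph_sum; apply: eq_bigr => m _ /=.
rewrite rmorphM /mmap1 rmorph_prod; congr (_ * _).
by apply: eq_bigr => i _; rewrite rmorphXn.
Qed.

Lemma eq_mmap (n : nat) (R S : nzRingType) (f f' : R -> S) (h h' : 'I_n -> S)
    (p : {mpoly R[n]}) : f =1 f' -> h =1 h' -> mmap f h p = mmap f' h' p.
Proof.
move=> ff hh; apply: eq_bigr => m _; rewrite ff; congr (_ * _).
by apply: eq_bigr => i _; rewrite hh.
Qed.

Lemma mmap_comp_mpoly (n k : nat) (R S : comNzRingType) (f : {rmorphism R -> S})
    (h : 'I_k -> S) (lq : n.-tuple {mpoly R[k]}) (p : {mpoly R[n]}) :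
  mmap f h (p \mPo lq) = mmap f (fun i => mmap f h (tnth lq i)) p.
Proof.
rewrite /comp_mpoly (rmorph_mmap (@mpolyC k R) (mmap f h)).
by apply: eq_mmap => // c /=; rewrite mmapC.
Qed.

Lemma mmap_dhomog (n : nat) (R : nzRingType) (S : comNzRingType)
    (f : {rmorphism R -> S}) (h : 'I_n -> S) (c : S) d (p : {mpoly R[n]}) :
  p \is d.-homog -> mmap f (fun i => c * h i) p = c ^+ d * mmap f h p.
Proof.
move=> /dhomogP hp; rewrite /mmap mulr_sumr; apply: eq_big_seq => m /hp; rewrite /= => <-.
rewrite mulrCA; congr (_ * _); rewrite /mmap1 mdegE -prodrXr -big_split /=.
by apply: eq_bigr => i _; rewrite exprMn.
Qed.

Lemma mmap_mpoly_id (n : nat) (R : nzRingType) (p : {mpoly R[n]}) :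
  mmap (@mpolyC n R) (fun i => 'X_i) p = p.
Proof.
rewrite [RHS]mpolyE; apply: eq_bigr => m _.
by rewrite mmap1_id mul_mpolyC.
Qed.

(** Split off the exact powers of ['X] from [g] and [h]. The cofactors do not vanish at 0, so the
    powers add up to [d], and cancelling ['X^d] leaves two cofactors with constant product. *)
Lemma monomial_factor (R : idomainType) (c : R) d (g h : {poly R}) :
  c != 0 -> g * h = c%:P * 'X^d -> exists a k, g = a%:P * 'X^k.
Proof.
move=> c0 E.
have gh0 : g * h != 0 by rewrite E mulf_neq0 ?polyC_eq0 // monic_neq0 ?monicXn.
have [a [g1 ]] := multiplicity_XsubC g 0.
have [b [h1 ]] := multiplicity_XsubC h 0.
move: gh0; rewrite mulf_eq0 negb_or => /andP[-> ->] /=.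
rewrite subr0 => h10 Eh g10 Eg.
have ghE : (g1 * h1) * 'X^(a + b) = c%:P * 'X^d by rewrite -E Eg Eh exprD; ring.
have abd : (a + b = d)%N.
  apply/eqP; move/(congr1 (fun p : {poly R} => p`_(a + b))): ghE => /=.
  rewrite coefMXn ltnn subnn coefCM coefXn.
  case: eqP => // _; rewrite mulr0 -horner_coef0 hornerM => /eqP.
  by rewrite mulf_eq0 -!rootE (negPf h10) (negPf g10).
move: ghE; rewrite abd => /mulIf; rewrite monic_neq0 ?monicXn // => /(_ isT) ghE.
have: size (g1 * h1) == 1%N by rewrite ghE size_polyC c0.
rewrite size_mul_eq1 => /andP[/size_poly1P[u _ Eu] _].
by exists u, a; rewrite Eg Eu.
Qed.

(* Substituting X_i -> X_i T turns a polynomial into the generating function of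
   its homogeneous components, and a form into a monomial in T. *)
Lemma dhomog_factor (n : nat) (R : idomainType) d (F G H : {mpoly R[n]}) :
  F != 0 -> F \is d.-homog -> F = G * H -> exists k, G \is k.-homog.
Proof.
move=> F0 homF FGH.
pose f : {rmorphism R -> {poly {mpoly R[n]}}} := polyC \o @mpolyC n R.
pose h i : {poly {mpoly R[n]}} := 'X * ('X_i)%:P.
have fE p : mmap f (fun i => ('X_i)%:P) p = p%:P.
  rewrite -[p in RHS](mmap_mpoly_id) (rmorph_mmap (@mpolyC n R) polyC).
  exact: eq_mmap.
(* The variable of the outer polynomial ring plays the part of T, so the form [F] becomes [F]
   T^d. *)
have /(monomial_factor F0)[a [k Ea]] : mmap f h G * mmap f h H = F%:P * 'X^d.
  by rewrite -rmorphM -FGH [LHS](mmap_dhomog f (fun i => ('X_i)%:P) 'X homF) fE mulrC.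
exists k; apply/dhomogP => m mG.
(* The coefficient of T^([mdeg m]) is the homogeneous component of [G] of that degree, and [m] keeps
   its nonzero coefficient there. As only T^k occurs, [mdeg m] must be [k]. *)
have: (mmap f h G)`_(mdeg m)@_m != 0.
  rewrite [in mmap _ _ _](mpolyE G) raddf_sum /= coef_sum raddf_sum /=.
  rewrite (bigD1_seq m) //= ?msupp_uniq // mmapZ mmapX.
  have mm m' : mmap1 h m' = 'X_[m']%:P * 'X^(mdeg m').
    rewrite -fE mmapX /mmap1 mdegE -prodrXr -big_split /=.
    by apply: eq_bigr => i _; rewrite exprMn mulrC.
  rewrite mm coefCM coefMXn ltnn subnn coefC eqxx mul_mpolyC mcoeffZ mcoeffX.
  rewrite eqxx mulr1 big1_seq ?addr0 -?mcoeff_msupp // => m' /andP[m'm _].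
  rewrite mmapZ mmapX mm coefCM mul_mpolyC mcoeffZ coefCM coefXn -mulr_natr.
  rewrite mul1r; case: eqP => _.
    by rewrite mulr1 mcoeffX (negPf m'm) mulr0.
  by rewrite mulr0 mcoeff0 mulr0.
rewrite Ea coefCM coefXn; case: (mdeg m =P k) => // _.
by rewrite mulr0n mulr0 mcoeff0 eqxx.
Qed.

(** * Restriction of ternary forms to a coordinate line *)

Lemma ord3_distinct (i j l : 'I_3) : uniq [:: i; j; l] ->
  [/\ i != j, i != l, j != l & forall t, [|| t == i, t == j | t == l]].
Proof.
move: i j l => [[|[|[|i]]] //= Hi] [[|[|[|j]]] //= Hj] [[|[|[|l]]] //= Hl] //=;
  rewrite ?inE -?val_eqE //= => _;
  by split=> // -[[|[|[|t]]] //= Ht]; rewrite -?val_eqE.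
Qed.

Lemma mmap1_ord3 (S : comNzRingType) (h : 'I_3 -> S) (i j l : 'I_3) m :
  uniq [:: i; j; l] -> mmap1 h m = h i ^+ m i * h j ^+ m j * h l ^+ m l.
Proof.
move=> /ord3_distinct[ij il jl tE]; rewrite /mmap1.
rewrite (bigD1 i) //= (bigD1 j) /= 1?eq_sym // (bigD1 l) /=; last first.
  by rewrite ![l == _]eq_sym il jl.
rewrite big1 ?mulr1 ?mulrA // => t.
by case/or3P: (tE t) => /eqP ->; rewrite eqxx ?andbF.
Qed.

Lemma mdeg_ord3 (m : 'X_{1..3}) (i j l : 'I_3) :
  uniq [:: i; j; l] -> mdeg m = (m i + m j + m l)%N.
Proof.
move=> /ord3_distinct[ij il jl tE]; rewrite mdegE.
rewrite (bigD1 i) //= (bigD1 j) /= 1?eq_sym // (bigD1 l) /=; last first.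
  by rewrite ![l == _]eq_sym il jl.
rewrite big1 ?addn0 ?addnA // => t.
by case/or3P: (tE t) => /eqP ->; rewrite eqxx ?andbF.
Qed.

Lemma edge_mnm (i j l : 'I_3) (m : 'X_{1..3}) : uniq [:: i; j; l] ->
  m l = 0%N -> m = (U_(i) *+ m i + U_(j) *+ m j)%MM.
Proof.
move=> /ord3_distinct[ij il jl tE] ml; apply/mnmP => t.
rewrite !(mnmDE, mulmnE, mnm1E).
by case/or3P: (tE t) => /eqP ->;
  rewrite ?ml ?eqxx ?[j == i]eq_sym ?(negPf ij) ?(negPf il) ?(negPf jl); lia.
Qed.

(* Parametrises the line on which the third coordinate vanishes. *)
Definition edge (K : fieldType) (i j : 'I_3) (t : 'I_3) : {poly K} :=
  if t == i then 'X else if t == j then 1 else 0.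

(** Monomials involving the third variable vanish on the line; among the others, homogeneity makes
    the exponent of [i] determine that of [j], so no two monomials merge. *)
Lemma coef_edge (K : fieldType) (i j l : 'I_3) d (F : {mpoly K[3]}) k :
  uniq [:: i; j; l] -> F \is d.-homog -> (k <= d)%N ->
  (mmap polyC (edge K i j) F)`_k = F@_(U_(i) *+ k + U_(j) *+ (d - k))%MM.
Proof.
move=> u homF kd; pose m := (U_(i) *+ k + U_(j) *+ (d - k))%MM.
have [ij il jl _] := ord3_distinct u.
have mE m' : (m' == m) = [&& m' i == k, m' j == (d - k)%N & m' l == 0%N].
  apply/eqP/and3P => [->|[/eqP mi /eqP mj /eqP ml]].
    rewrite !(mnmDE, mulmnE, mnm1E) !eqxx ?[j == i]eq_sym.
    by rewrite (negPf ij) (negPf il) (negPf jl) /= ?mul1n ?mul0n ?addn0 ?add0n ?eqxx.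
  by rewrite (edge_mnm u ml) mi mj.
rewrite -/m /mmap coef_sum.
have term m' : m' \in msupp F ->
    ((F@_m')%:P * mmap1 (edge K i j) m')`_k = F@_m' *+ (m' == m).
  move=> /(dhomogP _ _ _ homF) /= dm'.
  move: dm'; rewrite (mdeg_ord3 _ u) => dm'.
  rewrite (mmap1_ord3 _ _ u) /edge eqxx [j == i]eq_sym (negPf ij) eqxx.
  rewrite ![l == _]eq_sym (negPf il) (negPf jl) expr1n mulr1 coefCM mE.
  case: (m' l =P 0%N) => [ml|/eqP ml]; last first.
    by rewrite expr0n (negPf ml) mulr0 coef0 mulr0 !andbF.
  rewrite ml expr0 mulr1 coefXn andbT eq_sym.
  case: (m' i =P k) => [mi|_]; last by rewrite mulr0n mulr0.
  have -> : m' j == (d - k)%N by lia.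
  by rewrite mulr1.
rewrite (eq_big_seq _ term).
case mF : (m \in msupp F).
  by rewrite (bigD1_seq m) ?msupp_uniq //= eqxx big1 ?addr0 // => m' /negPf ->.
rewrite (memN_msupp_eq0 (negbT mF)) big1_seq // => m' /andP[_ m'F].
by case: eqP => // mm; rewrite -mm m'F in mF.
Qed.

Lemma size_edge (K : fieldType) (i j l : 'I_3) d (F : {mpoly K[3]}) :
  uniq [:: i; j; l] -> F \is d.-homog -> (size (mmap polyC (edge K i j) F) <= d.+1)%N.
Proof.
move=> u homF; apply/leq_sizeP => k dk; rewrite /mmap coef_sum big1_seq // => m /=.
move=> /(dhomogP _ _ _ homF) /=; rewrite (mdeg_ord3 _ u) => dm.
have [ij il jl _] := ord3_distinct u.
rewrite (mmap1_ord3 _ _ u) /edge eqxx [j == i]eq_sym (negPf ij) eqxx.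
rewrite ![l == _]eq_sym (negPf il) (negPf jl) expr1n mulr1 coefCM.
case: (m l =P 0%N) => [->|/eqP ml].
  rewrite mulr1 coefXn; case: eqP => [km|]; last by rewrite mulr0.
  lia.
by rewrite expr0n (negPf ml) mulr0 coef0 mulr0.
Qed.

Lemma mpolyX_factor (K : fieldType) (n : nat) (i : 'I_n) (F : {mpoly K[n]}) :
  (forall m, m \in msupp F -> (0 < m i)%N) -> exists G, F = 'X_i * G.
Proof.
move=> pos; exists (\sum_(m <- msupp F) F@_m *: 'X_[m - U_(i)]).
rewrite [LHS]mpolyE mulr_sumr; apply: eq_big_seq => m /pos mi.
rewrite -scalerAr -mpolyXD; congr (_ *: 'X_[_]).
apply/mnmP => t; rewrite mnmDE mnmBE mnm1E.
by case: (i =P t) => [<-|_]; rewrite ?subn0 //=; lia.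
Qed.

(** Otherwise the coordinate ['X_i] divides [F], irreducibility makes the cofactor constant, and [F]
    has degree 1. *)
Lemma irreducible_mpolyX_factor (K : fieldType) d (i : 'I_3) (F : {mpoly K[3]}) :
  irr_plane_curve d F -> (1 < d)%N -> exists2 m, m \in msupp F & m i = 0%N.
Proof.
move=> [F0 [homF [_ irr]]] d1.
case: (boolP (has (fun m : 'X_{1..3} => m i == 0%N) (msupp F))) => [/hasP[m ? /eqP]|].
  by exists m.
rewrite -all_predC => /allP pos.
have [G FG] : exists G, F = 'X_i * G.
  by apply: mpolyX_factor => m /pos /=; rewrite lt0n.
have G0 : G != 0 by apply: contraNneq F0 => G0; rewrite FG G0 mulr0.
case: (irr _ _ FG) => [|G1]; first by rewrite msizeX mdeg1.
have := dhomog_uniq F0 homF; move=> /(_ 1%N) /=.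
rewrite FG (msize1_polyC G1) mulrC mul_mpolyC => uniq1.
have: d = 1%N by apply: uniq1; apply: dhomogZ; rewrite dhomogX /= mdeg1.
by move=> d1'; rewrite d1' in d1.
Qed.

Lemma edge_neq0 (K : fieldType) (i j l : 'I_3) d (F : {mpoly K[3]}) :
  uniq [:: i; j; l] -> irr_plane_curve d F -> (1 < d)%N ->
  mmap polyC (edge K i j) F != 0.
Proof.
move=> u irrF d1; have [m mF ml] := irreducible_mpolyX_factor l irrF d1.
have [F0 [homF _]] := irrF.
have := mF => /(dhomogP _ _ _ homF) /=; rewrite (mdeg_ord3 _ u) ml addn0 => dm.
have kd : (m i <= d)%N by lia.
have [ij il jl _] := ord3_distinct u.
apply: contraTneq mF => E; have := coef_edge u homF kd; rewrite E coef0.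
have -> : (U_(i) *+ m i + U_(j) *+ (d - m i))%MM = m.
  by rewrite [RHS](edge_mnm u ml) -dm addKn.
by move/esym/eqP; rewrite mcoeff_eq0.
Qed.

(** * Univariate polynomials *)

(** If both factors have positive degree in the outer variable, their reductions at [eta] are
    constants, so both leading coefficients vanish at [eta] and the root is not simple. A factor
    lying in the inner ring has no root [xi], since [f] would reduce to 0 there; hence it is a
    constant of [K]. *)
Lemma reversed_eisenstein (K : closedFieldType) (eta : K) (f g h : {poly {poly K}}) :
  root (lead_coef f) eta -> ~~ root (lead_coef f)^`() eta ->
  (forall xi, root (lead_coef f) xi ->
     exists2 c, c != 0 & map_poly (horner_eval xi) f = c%:P) ->
  f = g * h -> (exists c : K, g = c%:P%:P) \/ (exists c : K, h = c%:P%:P).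
Proof.
move=> r0 r1 red fgh.
have [c c0 fc] := red eta r0.
have szfg : size (map_poly (horner_eval eta) g * map_poly (horner_eval eta) h) == 1%N.
  by rewrite -rmorphM /= -fgh fc size_polyC c0.
have lead0 (u : {poly {poly K}}) : size (map_poly (horner_eval eta) u) = 1%N ->
    (1 < size u)%N -> root (lead_coef u) eta.
  move=> szu u1; rewrite /root lead_coefE -[_.[eta]]/(horner_eval eta _) -coef_map.
  by rewrite nth_default // szu; lia.
have constP (u v : {poly {poly K}}) : f = u * v -> (size u <= 1)%N ->
    exists c : K, u = c%:P%:P.
  move=> fuv /size1_polyC Eu; rewrite {1}Eu.
  have [/size_poly1P[a _ ->]|/closed_rootP[xi xiP]] := boolP (size (u`_0) == 1%N).
    by exists a.
  have [|d d0 fd] := red xi.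
    by rewrite fuv Eu lead_coefM lead_coefC rootM xiP.
  move: fd; rewrite fuv Eu rmorphM /= map_polyC /= /horner_eval (rootP xiP) mul0r.
  by move/esym/eqP; rewrite polyC_eq0 (negPf d0).
move: szfg; rewrite size_mul_eq1 => /andP[/eqP szg /eqP szh].
case: (leqP (size g) 1) => [|g1]; first by move/(constP _ _ fgh); left.
case: (leqP (size h) 1) => [|h1].
  by rewrite mulrC in fgh; move/(constP _ _ fgh); right.
have := lead0 _ szg g1; have := lead0 _ szh h1.
move=> /factor_theorem[a Ea] /factor_theorem[b Eb]; case/negP: r1.
rewrite fgh lead_coefM Ea Eb !derivM !derivB derivX derivC subr0.
by apply/rootP; rewrite !(hornerD, hornerM, hornerN, hornerX, hornerC); ring.
Qed.

(** * Polynomials invariant under translations or dilations *)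

(** Divide by [U]: uniqueness of division makes quotient and remainder invariant too. The remainder
    takes its value at 0 on all [q] elements of [s], yet has degree below [q], so it is constant;
    induction handles the quotient. *)
Lemma translation_invariant_comp (R : idomainType) (q : nat) (U : {poly R})
    (s : seq R) (P : {poly R}) :
  (0 < q)%N -> U \is monic -> size U = q.+1 -> uniq s -> size s = q ->
  (forall c, c \in s -> U \Po ('X + c%:P) = U) ->
  (forall c, c \in s -> P \Po ('X + c%:P) = P) ->
  exists Q, P = Q \Po U.
Proof.
move=> q0 monU szU us szs invU; have [N] := ubnP (size P); elim: N P => // N IH P.
rewrite ltnS => szP invP.
set A := Pdiv.CommonRing.rdivp P U; set B := Pdiv.CommonRing.rmodp P U.
have PAB : P = A * U + B by apply: Pdiv.RingMonic.rdivp_eq.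
have szB : (size B <= q)%N.
  by rewrite -ltnS -szU Pdiv.CommonRing.ltn_rmodpN0 // monic_neq0.
have invAB c : c \in s -> A \Po ('X + c%:P) = A /\ B \Po ('X + c%:P) = B.
  move=> cs; set A' := A \Po _; set B' := B \Po _.
  have E : (A' - A) * U = B - B'.
    have : A' * U + B' = A * U + B.
      by rewrite -PAB -[in RHS](invP c cs) PAB comp_polyD comp_polyM (invU c cs).
    by move=> /eqP; rewrite -subr_eq0 => /eqP E; rewrite -[LHS]subr0 -[X in _ - X]E; ring.
  have szBB : (size (B - B')%R <= q)%N.
    rewrite (leq_trans (size_polyD _ _)) // geq_max szB size_polyN.
    rewrite size_comp_poly2 // size_polyDl size_polyX //.
    by rewrite ltnS size_polyC; case: eqP.
  (* A nonzero multiple of the monic [U] has size above [q], the bound on the size of [B - B']. *)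
  have AA : A' - A = 0.
    apply/eqP/contraT => AA; move: szBB; rewrite -E size_Mmonic // szU.
    by rewrite -size_poly_eq0 in AA; lia.
  by move: E; rewrite AA mul0r => /esym /subr0_eq ->; move/subr0_eq: AA.
have [b Bb] : exists b, B = b%:P.
  exists B.[0]; apply/eqP; rewrite -subr_eq0; apply/contraT => B0.
  have /(max_poly_roots B0) /(_ us): all (root (B - B.[0]%:P)) s.
    apply/allP => c /invAB[_ Bc]; rewrite /root hornerD hornerN hornerC subr_eq0.
    by rewrite -[in X in _ == X]Bc horner_comp !hornerE.
  rewrite szs => szBB; have := leq_trans szBB (size_polyD _ _).
  by rewrite size_polyN leq_max ltnNge szB /= size_polyC; case: eqP => _ /=; lia.
have [A00|A0] := eqVneq A 0.
  by exists b%:P; rewrite PAB A00 mul0r add0r Bb comp_polyC.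
have [|c cs|Q AQ] := IH A; last first.
- by exists (Q * 'X + b%:P); rewrite comp_polyD comp_polyM comp_polyX comp_polyC -AQ -Bb.
- by case: (invAB c cs).
- have szA : (0 < size A)%N by rewrite size_poly_gt0.
  have szAU : size (A * U) = (size A + q)%N by rewrite size_Mmonic // szU addnS.
  apply: leq_trans szP; rewrite PAB size_polyDl szAU.
    by rewrite -[ltnLHS]addn0 ltn_add2l.
  by apply: (leq_ltn_trans szB); rewrite -[ltnLHS]add0n ltn_add2r.
Qed.

Lemma coef_comp_scaleX (R : comNzRingType) (c : R) (P : {poly R}) i :
  (P \Po (c *: 'X))`_i = c ^+ i * P`_i.
Proof.
rewrite coef_comp_poly; under eq_bigr => j _ do rewrite exprZn coefZ coefXn mulr_natr.
have [iP|Pi] := ltnP i (size P).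
  rewrite (bigD1 (Ordinal iP)) //= eqxx mulr1n mulrC big1 ?addr0 // => j ij.
  by rewrite (_ : (i == j) = false) ?mulr0n ?mulr0 // eq_sym; apply/negbTE.
rewrite (nth_default _ Pi) mulr0 big1 // => j _.
by rewrite gtn_eqF ?mulr0n ?mulr0 // (leq_trans (ltn_ord j)).
Qed.

(** A nonzero coefficient of index i forces c^(i mod k) = 1 for all [k] elements c of [s]; if k does
    not divide i, the nonzero polynomial X^(i mod k) - 1 has too few roots for that. *)
Lemma dilation_invariant_comp (R : idomainType) (k : nat) (s : seq R) (P : {poly R}) :
  (0 < k)%N -> uniq s -> size s = k -> (forall c, c \in s -> c ^+ k = 1) ->
  (forall c, c \in s -> P \Po (c *: 'X) = P) ->
  exists Q, P = Q \Po 'X^k.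
Proof.
move=> k0 us szs s1 invP.
have coefP i : ~~ (k %| i)%N -> P`_i = 0.
  rewrite /dvdn -lt0n => ik; apply/eqP/contraT => Pi.
  have szr : size ('X^(i %% k) - 1 : {poly R})%R = (i %% k).+1 by rewrite size_XnsubC.
  have: all (root ('X^(i %% k) - 1)) s.
    apply/allP => c cs; apply/rootP; rewrite !(hornerD, hornerN, hornerXn, hornerC).
    have := congr1 (fun p : {poly R} => p`_i) (invP c cs); rewrite /= coef_comp_scaleX.
    rewrite {1}(divn_eq i k) exprD mulnC exprM (s1 c cs) expr1n mul1r => cP.
    by apply: (mulIf Pi); rewrite mulrBl cP mul1r subrr mul0r.
  move/(max_poly_roots _) => /(_ _ us); rewrite szs szr ltnS leqNgt ltn_pmod // => H.
  by apply: H; rewrite -size_poly_eq0 szr.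
exists (\poly_(i < size P) P`_(i * k)); apply/polyP => i.
rewrite coef_comp_poly_Xn //; case: ifPn => [ki|/coefP //].
rewrite coef_poly divnK //; case: ltnP => // Pi.
by rewrite nth_default // (leq_trans Pi) // leq_div.
Qed.

(** * Frobenius powers and the elements of F_q *)

Definition frobenius_power (R : nzRingType) (q : nat) : Prop :=
  forall x y : R, (x + y) ^+ q = x ^+ q + y ^+ q.

Lemma pchar_frobenius_power (R : comNzRingType) p n :
  p \in [pchar R] -> frobenius_power R (p ^ n)%N.
Proof.
move=> pR x y; apply: GRing.exprDn_pchar; rewrite pnatX; apply/orP; left.
by rewrite pnatE ?(GRing.pcharf_prime pR).
Qed.

Lemma frobenius_powerN (R : nzRingType) q (x : R) :
  (0 < q)%N -> frobenius_power R q -> (- x) ^+ q = - x ^+ q.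
Proof.
move=> q0 fr; apply/eqP; rewrite -addr_eq0 addrC -fr subrr expr0n.
by rewrite (gtn_eqF q0).
Qed.

Lemma frobenius_powerB (R : nzRingType) q (x y : R) :
  (0 < q)%N -> frobenius_power R q -> (x - y) ^+ q = x ^+ q - y ^+ q.
Proof. by move=> q0 fr; rewrite fr frobenius_powerN. Qed.

(** X^q - X splits, and its derivative is -1, so its [q] roots are distinct. *)
Lemma closed_field_Fq (K : closedFieldType) (q : nat) :
  (1 < q)%N -> q%:R = 0 :> K ->
  exists s : seq K, [/\ uniq s, size s = q & forall x, (x \in s) = in_Fq q x].
Proof.
move=> q1 qK; pose P : {poly K} := 'X^q - 'X.
have szP : size P = q.+1 by rewrite size_polyDl size_polyXn // size_polyN size_polyX.
have lcP : lead_coef P = 1.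
  by rewrite lead_coefDl ?lead_coefXn // size_polyN size_polyX size_polyXn.
have [s Es] := closed_field_poly_normal P; rewrite lcP scale1r in Es.
exists s; split.
- rewrite -separable.separable_prod_XsubC -Es separable.separable_poly.unlock.
  rewrite derivB derivXn derivX -mulr_natl -polyC_natr qK mul0r sub0r.
  by rewrite -scaleN1r coprimepZr ?oppr_eq0 ?oner_eq0 // coprimep1.
- by move: szP; rewrite Es size_prod_XsubC => -[].
- by move=> x; rewrite -root_prod_XsubC -Es rootE !hornerE subr_eq0.
Qed.

(** * Semi-invariance under AGL(2,q) and the lower bound *)

Lemma frobenius_power_sum (R : nzRingType) q (I : Type) (r : seq I) (f : I -> R) :
  (0 < q)%N -> frobenius_power R q -> (\sum_(i <- r) f i) ^+ q = \sum_(i <- r) f i ^+ q.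
Proof.
move=> q0 fr; elim: r => [|x r IH]; first by rewrite !big_nil expr0n gtn_eqF.
by rewrite !big_cons fr IH.
Qed.

Lemma AGL2_inv (K : fieldType) q (A : 'M[K]_3) :
  (0 < q)%N -> frobenius_power K q -> AGL2 q A -> AGL2 q (invmx A).
Proof.
move=> q0 fr [Aq [uA [A20 A21]]]; have uB := uA; rewrite -unitmx_inv in uB.
have AB := mulmxV uA.
have A22 j : A 2%:R 2%:R * invmx A 2%:R j = (2%:R == j)%:R.
  have := congr1 (fun M : 'M_3 => M 2%:R j) AB; rewrite !mxE.
  rewrite !big_ord_recl big_ord0.
  have -> : ord0 = 0 :> 'I_3 by apply/val_inj.
  have -> : lift 0 ord0 = 1 :> 'I_3 by apply/val_inj.
  have -> : lift 0 (lift ord0 ord0) = 2%:R :> 'I_3 by apply/val_inj.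
  by rewrite A20 A21 !mul0r !add0r addr0.
have A22n : A 2%:R 2%:R != 0.
  by apply/eqP => A0; have /eqP := A22 2%:R; rewrite A0 mul0r eqxx eq_sym oner_eq0.
split; last by split=> //; split; apply: (mulfI A22n); rewrite A22 mulr0.
(* Raising entries to the power [q] respects products and fixes [A], so the image of [invmx A] is
   again a right inverse of [A]. *)
have E : map_mx (fun x => x ^+ q) (invmx A) = invmx A.
  rewrite -[LHS]mul1mx -(mulVmx uA) -mulmxA; rewrite -[RHS]mulmx1; congr (_ *m _).
  rewrite -AB; apply/matrixP => i j; rewrite !mxE.
  have -> : \sum_k A i k * invmx A k j = (i == j)%:R.
    by have := congr1 (fun M : 'M_3 => M i j) AB; rewrite !mxE.
  transitivity (((i == j)%:R : K) ^+ q); last by case: eqP; rewrite ?expr1n ?expr0n ?gtn_eqF.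
  have <- : \sum_k A i k * invmx A k j = (i == j)%:R.
    by have := congr1 (fun M : 'M_3 => M i j) AB; rewrite !mxE.
  rewrite frobenius_power_sum //; apply: eq_bigr => k _.
  by rewrite mxE exprMn (eqP (Aq i k)).
by move=> i j; rewrite /in_Fq; apply/eqP; rewrite -[in RHS]E mxE.
Qed.

Lemma G_invariant_pullback (K : fieldType) q (F : {mpoly K[3]}) (B : 'M[K]_3) :
  (0 < q)%N -> frobenius_power K q -> G_invariant (AGL2 q) F -> AGL2 q B ->
  exists2 c : K, c != 0 & pullback B F = c *: F.
Proof.
by move=> q0 fr inv /(AGL2_inv q0 fr) /inv; rewrite /curve_invariant invmxK.
Qed.

Lemma mmap_pullback (K : fieldType) (S : comNzRingType) (f : {rmorphism K -> S})
    (h : 'I_3 -> S) (B : 'M[K]_3) (F : {mpoly K[3]}) :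
  mmap f h (pullback B F) = mmap f (fun i => \sum_j f (B i j) * h j) F.
Proof.
rewrite /pullback mmap_comp_mpoly; apply: eq_mmap => // i.
rewrite tnth_mktuple raddf_sum; apply: eq_bigr => j _ /=.
by rewrite mmapZ mmapX mmap1U.
Qed.

(** The substitution X -> d X + b Y + c Z fixing Y and Z. Together with the exchange of X and Y,
    these are the only group elements from which the lower bound is derived. *)
Definition rowmx3 (K : fieldType) (d b c : K) : 'M[K]_3 :=
  \matrix_(i, j) nth 0 (nth [::] [:: [:: d; b; c]; [:: 0; 1; 0]; [:: 0; 0; 1]] i) j.

Definition swapmx3 (K : fieldType) : 'M[K]_3 :=
  \matrix_(i, j) nth 0 (nth [::] [:: [:: 0; 1; 0]; [:: 1; 0; 0]; [:: 0; 0; 1]] i) j.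

Lemma sum_ord3 (S : nmodType) (g : 'I_3 -> S) :
  \sum_j g j = g 0 + g 1 + g 2%:R.
Proof.
rewrite !big_ord_recl big_ord0 addr0 addrA; congr (_ + _ + g _); try congr g; exact: val_inj.
Qed.

Lemma rowmx3_AGL2 (K : fieldType) q (d b c : K) :
  (0 < q)%N -> d != 0 -> in_Fq q d -> in_Fq q b -> in_Fq q c -> AGL2 q (rowmx3 d b c).
Proof.
move=> q0 d0 dq bq cq.
have Fq0 : in_Fq q (0 : K) by rewrite /in_Fq expr0n gtn_eqF.
have Fq1 : in_Fq q (1 : K) by rewrite /in_Fq expr1n.
split; last split; last by rewrite !mxE.
  by move=> [[|[|[|i]]] //= Hi] [[|[|[|j]]] //= Hj]; rewrite mxE.
have: rowmx3 d b c *m rowmx3 d^-1 (- b / d) (- c / d) = 1%:M.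
  apply/matrixP => i j; rewrite !mxE sum_ord3 !mxE /=.
  by move: i j => [[|[|[|i]]] //= Hi] [[|[|[|j]]] //= Hj]; field.
by case/mulmx1_unit.
Qed.

Lemma swapmx3_AGL2 (K : fieldType) q : (0 < q)%N -> AGL2 q (swapmx3 K).
Proof.
move=> q0.
have Fq0 : in_Fq q (0 : K) by rewrite /in_Fq expr0n gtn_eqF.
have Fq1 : in_Fq q (1 : K) by rewrite /in_Fq expr1n.
split; last split; last by rewrite !mxE.
  by move=> [[|[|[|i]]] //= Hi] [[|[|[|j]]] //= Hj]; rewrite mxE.
have: swapmx3 K *m swapmx3 K = 1%:M.
  apply/matrixP => i j; rewrite !mxE sum_ord3 !mxE /=.
  by move: i j => [[|[|[|i]]] //= Hi] [[|[|[|j]]] //= Hj]; ring.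
by case/mulmx1_unit.
Qed.

Lemma comp_poly_inj (R : idomainType) (w P P' : {poly R}) :
  (1 < size w)%N -> P \Po w = P' \Po w -> P = P'.
Proof.
move=> szw E; apply/eqP; rewrite -subr_eq0 -lead_coef_eq0.
have: lead_coef ((P - P') \Po w) == 0 by rewrite comp_polyB E subrr lead_coef0.
rewrite lead_coef_comp // mulf_eq0 => /orP[//|].
rewrite expf_eq0 => /andP[_]; rewrite (lead_coef_eq0 w) => /eqP w0.
by rewrite w0 size_poly0 in szw.
Qed.

Lemma rmorph_frobenius_power (R S : comNzRingType) (f : {rmorphism R -> S}) p n :
  p \in [pchar R] -> frobenius_power S (p ^ n)%N.
Proof. by move=> pR; apply: pchar_frobenius_power; apply: rmorph_pchar f _ _. Qed.

(** * Possible degrees of invariant curves *)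

(** [k = 0] is excluded by [1 < e], and for [k >= 2] one has 2 (q^3 - q^2) - (q^3 - q) = q (q - 1)^2
    >= 0. *)
Lemma degree_gap q k e : (1 < q)%N -> (1 < e)%N -> e = (k * (q * q * q.-1))%N ->
  e = (q ^ 3 - q ^ 2)%N \/ (q ^ 3 - q <= e)%N.
Proof.
case: q => // r; rewrite /= => r1; case: k => [|[|k]] e1 eE; first lia.
  by left; nia.
by right; nia.
Qed.

Lemma degree_gap_vanishing q k e : (0 < q)%N -> (0 < k)%N ->
  (k * (q * q * q.-1) <= e)%N -> (q * q.-1 <= e - k * (q * q * q.-1))%N ->
  (q ^ 3 - q <= e)%N.
Proof. by case: q => // r; case: k => // k _ _ /=; nia. Qed.

(* The hypotheses record what survives of AGL(2,q)-invariance on the line at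
   infinity Z = 0, where translations act trivially but force f to be a
   polynomial in X^q. *)
Lemma degree_line_at_infinity (K : closedFieldType) p n q e (f P0 : {poly K})
    (s : seq K) chi :
  p \in [pchar K] -> q = (p ^ n)%N -> (1 < q)%N -> (1 < e)%N ->
  uniq s -> size s = q -> (forall x, (x \in s) = in_Fq q x) ->
  f != 0 -> f = P0 \Po 'X^q ->
  (forall b, in_Fq q b -> exists c, f \Po ('X + b%:P) = c *: f) ->
  (forall d, in_Fq q d -> d != 0 -> f \Po (d *: 'X) = f) ->
  (size f <= e.+1)%N -> chi != 0 ->
  (forall k, (k <= e)%N -> f`_(e - k) = chi * f`_k) ->
  e = (q ^ 3 - q ^ 2)%N \/ (q ^ 3 - q <= e)%N.
Proof.
move=> pK qE q1 e1 us szs sE f0 fP0 ftr fdil szf chi0 fswap.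
have q0 : (0 < q)%N by lia.
have frX : frobenius_power {poly K} q.
  by rewrite qE; apply: (rmorph_frobenius_power polyC).
have szX m : size ('X^m : {poly K}) = m.+1 by rewrite size_polyXn.
(* Translation preserves the leading coefficient of [f], so the multiplier [c] is 1; as b^q = b,
   translation by [b] commutes with X -> X^q, and ['X^q] can be cancelled on the right. *)
have trP0 b : b \in s -> P0 \Po ('X + b%:P) = P0.
  rewrite sE => bq; have [c fc] := ftr b bq.
  have c1 : c = 1.
    have := congr1 lead_coef fc; rewrite lead_coef_comp; last first.
      by rewrite size_XaddC.
    rewrite lead_coefXaddC expr1n mulr1 lead_coefZ => /esym fcE.
    by apply: (mulIf (x := lead_coef f)); rewrite ?lead_coef_eq0 // fcE mul1r.
  apply: (comp_poly_inj (w := 'X^q)); first by rewrite szX.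
  move: fc; rewrite c1 scale1r fP0 -!comp_polyA => <-; congr (_ \Po _).
  rewrite comp_polyD comp_polyX comp_polyC comp_Xn_poly frX -polyC_exp.
  by rewrite (eqP bq).
pose U : {poly K} := 'X^q - 'X.
have szU : size U = q.+1 by rewrite size_polyDl szX // size_polyN size_polyX.
have monU : U \is monic.
  by rewrite monicE lead_coefDl ?lead_coefXn // size_polyN size_polyX szX.
have [P1 P0P1] : exists Q, P0 = Q \Po U.
  apply: (translation_invariant_comp q0 monU szU us szs) => // b.
  rewrite sE => bq; rewrite comp_polyB comp_Xn_poly comp_polyX frX -polyC_exp (eqP bq).
  by rewrite /U; ring.
pose w := U \Po 'X^q.
have fP1 : f = P1 \Po w by rewrite fP0 P0P1 -comp_polyA.
have szw : size w = (q * q).+1.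
  have := size_comp_poly U 'X^q; rewrite szU szX /= -/w => szw.
  by case: (size w) szw => [|m] /= szw; nia.
have wE : w = 'X^(q * q) - 'X^q.
  by rewrite /w /U comp_polyB comp_Xn_poly comp_polyX exprM.
(* The polynomial [w] is F_q-linear: replacing X by d X multiplies it by d. *)
have dilP1 d : d \in [seq x <- s | x != 0] -> P1 \Po (d *: 'X) = P1.
  rewrite mem_filter sE => /andP[d0 dq].
  apply: (comp_poly_inj (w := w)); first by rewrite szw; lia.
  rewrite -comp_polyA comp_polyZ comp_polyX -[RHS]fP1 -(fdil d dq d0) fP1 -comp_polyA.
  congr (_ \Po _); rewrite wE comp_polyB !comp_Xn_poly !exprZn scalerBr (exprM d).
  by rewrite (eqP dq) (eqP dq).
have [P3 P1P3] : exists Q, P1 = Q \Po 'X^(q.-1).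
  apply: (dilation_invariant_comp _ _ _ _ dilP1); first by lia.
  - by rewrite filter_uniq.
  - rewrite size_filter -szs -(count_predC (pred1 0) s) count_uniq_mem // sE.
    by rewrite /in_Fq expr0n gtn_eqF // eqxx.
  - move=> d; rewrite mem_filter sE => /andP[d0 /eqP dq].
    by apply: (mulIf d0); rewrite mul1r -exprSr prednK.
have fP3 : f = P3 \Po (w ^+ q.-1) by rewrite fP1 P1P3 -comp_polyA comp_Xn_poly.
have szW : (size (w ^+ q.-1)).-1 = (q * q * q.-1)%N by rewrite size_exp szw.
have degf : (size f).-1 = ((size P3).-1 * (q * q * q.-1))%N.
  by rewrite fP3 size_comp_poly szW.
have wX : w = 'X^q * ('X^(q * q.-1) - 1).
  by rewrite wE mulrBr mulr1 -exprD -mulnS prednK.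
have fN : f`_((size f).-1) != 0 by rewrite -lead_coefE lead_coef_eq0.
have Ne : ((size f).-1 <= e)%N by lia.
(* By the symmetry, the top coefficient of [f] forces a nonzero coefficient in index [e - deg f],
   which bounds the order of vanishing of [f] at 0. *)
have fNe : f`_(e - (size f).-1) != 0 by rewrite fswap // mulf_neq0.
have P30 : P3 != 0 by apply: contraNneq f0 => P30; rewrite fP3 P30 comp_poly0.
(* If [P3] vanishes at 0, then [f] is divisible by w^(q-1), hence by X^(q(q-1)), so e exceeds deg f
   by at least q(q-1). Otherwise f(0) is nonzero and the symmetry gives deg f = e. *)
have [P3r|P3r] := boolP (root P3 0).
  right; have [P5 EP5] := factor_theorem _ _ P3r; move: EP5.
  rewrite subr0 => EP5.
  have low k : (k < q * q.-1)%N -> f`_k = 0.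
    move=> kq; rewrite fP3 EP5 comp_polyM comp_polyX wX exprMn -exprM mulrCA.
    by rewrite coefXnM kq.
  have: (q * q.-1 <= e - (size f).-1)%N.
    by rewrite leqNgt; apply: contra fNe => /low ->.
  have : (1 < size P3)%N.
    rewrite EP5 size_Mmonic ?monicX // ?size_polyX; last first.
      by apply: contraNneq P30 => P50; rewrite EP5 P50 mul0r.
    rewrite addn2 /= ltnS size_poly_gt0.
    by apply: contraNneq P30 => P50; rewrite EP5 P50 mul0r.
  move: Ne; rewrite degf => Ne szP3; apply: degree_gap_vanishing Ne => //.
  by rewrite -subn1 subn_gt0.
have fe : f`_0 != 0.
  rewrite -horner_coef0 fP3 horner_comp wX !(hornerE, hornerXn).
  by rewrite expr0n gtn_eqF // mul0r expr0n gtn_eqF // -subn1 subn_gt0.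
have fe' : f`_e != 0 by have := fswap 0%N isT; rewrite subn0 => ->; rewrite mulf_neq0.
apply: (degree_gap (k := (size P3).-1)) => //; rewrite -degf; apply/eqP.
rewrite eqn_leq Ne andbT -ltnS prednK ?size_poly_gt0 // ltnNge.
by apply: contra fe' => /leq_sizeP ->.
Qed.

Lemma ord3P (P : 'I_3 -> Prop) : P 0 -> P 1 -> P 2%:R -> forall i, P i.
Proof.
move=> P0 P1 P2 [[|[|[|i]]] //= Hi].
- by rewrite (_ : Ordinal Hi = 0) //; apply: val_inj.
- by rewrite (_ : Ordinal Hi = 1) //; apply: val_inj.
- by rewrite (_ : Ordinal Hi = 2%:R) //; apply: val_inj.
Qed.

Lemma mmap_rowmx3 (K : fieldType) (S : comNzRingType) (f : {rmorphism K -> S})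
    (h : 'I_3 -> S) (d b c : K) (F : {mpoly K[3]}) :
  mmap f h (pullback (rowmx3 d b c) F) =
  mmap f (fun i => if i == 0 then f d * h 0 + f b * h 1 + f c * h 2%:R else h i) F.
Proof.
rewrite mmap_pullback; apply: eq_mmap => //.
by apply: ord3P; rewrite sum_ord3 !mxE /= ?rmorph0 ?rmorph1 ?mul0r ?mul1r ?addr0 ?add0r.
Qed.

Lemma mmap_swapmx3 (K : fieldType) (F : {mpoly K[3]}) :
  mmap polyC (edge K 0 1) (pullback (swapmx3 K) F) = mmap polyC (edge K 1 0) F.
Proof.
rewrite mmap_pullback; apply: eq_mmap => //.
by apply: ord3P; rewrite sum_ord3 !mxE /edge /= ?rmorph0 ?rmorph1 ?mul0r ?mul1r ?addr0 ?add0r.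
Qed.

(** The task is to verify the hypotheses of [degree_line_at_infinity] for the restriction of [F] to
    Z = 0. The unknown multipliers of the dilations and of the translations by c Z are shown to be 1
    by restricting to lines on which these maps act trivially. *)
Lemma AGL2_invariant_degree (K : closedFieldType) p n q e :
  p \in [pchar K] -> q = (p ^ n)%N -> (1 < q)%N -> (1 < e)%N ->
  inv_degree (AGL2 (K := K) q) e -> e = (q ^ 3 - q ^ 2)%N \/ (q ^ 3 - q <= e)%N.
Proof.
move=> pK qE q1 e1 [F [irrF invF]]; have [F0 [homF _]] := irrF.
have q0 : (0 < q)%N by apply: ltnW.
have frK : frobenius_power K q by rewrite qE; apply: pchar_frobenius_power.
have frX : frobenius_power {poly K} q.
  by rewrite qE; apply: (rmorph_frobenius_power polyC).
have frXX : frobenius_power {poly {poly K}} q.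
  by rewrite qE; apply: pchar_frobenius_power; do 2!apply: (rmorph_pchar polyC).
have qK : q%:R = 0 :> K.
  rewrite qE natrX (GRing.pcharf0 pK) expr0n; case: n qE => // qE.
  by rewrite qE expn0 in q1.
have [s [us szs sE]] := closed_field_Fq q1 qK.
have Fq0 : in_Fq q (0 : K) by rewrite /in_Fq expr0n gtn_eqF.
have Fq1 : in_Fq q (1 : K) by rewrite /in_Fq expr1n.
have semi B : AGL2 q B -> exists2 c : K, c != 0 & pullback B F = c *: F.
  exact: G_invariant_pullback.
have u01 : uniq [:: 0; 1; 2%:R : 'I_3] by [].
have u10 : uniq [:: 1; 0; 2%:R : 'I_3] by [].
have u21 : uniq [:: 2%:R; 1; 0 : 'I_3] by [].
pose f := mmap polyC (edge K 0 1) F.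
have f0 : f != 0 by apply: edge_neq0 u01 irrF e1.
have row_f d b c : AGL2 q (rowmx3 d b c) ->
    exists2 chi, pullback (rowmx3 d b c) F = chi *: F &
      f \Po (d *: 'X + b%:P) = chi *: f.
  move=> /semi[chi chi0 chiE]; exists chi => //.
  have -> : chi *: f = mmap polyC (edge K 0 1) (chi *: F) by rewrite mmapZ mul_polyC.
  rewrite -chiE mmap_rowmx3.
  rewrite /f [LHS](rmorph_mmap polyC (comp_poly (d *: 'X + b%:P))).
  apply: eq_mmap => [x|]; first by rewrite /= comp_polyC.
  apply: ord3P; rewrite /= /edge /= ?comp_polyX ?comp_poly0 ?comp_polyC //.
  by rewrite mulr0 addr0 mulr1 mul_polyC.
(* The chart Y = 1, with X as outer and Z as inner variable; setting Z = 0 recovers [f]. *)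
pose P := mmap (polyC \o polyC) (fun i : 'I_3 => if i == 0 then 'X else
            if i == 1 then 1 else 'X%:P : {poly {poly K}}) F.
have PZ0 : map_poly (horner_eval 0) P = f.
  rewrite /P (rmorph_mmap _ (map_poly (horner_eval 0))).
  apply: eq_mmap => [x|]; first by rewrite /= map_polyC /= /horner_eval hornerC.
  apply: ord3P; rewrite /= /edge /= ?map_polyX ?rmorph1 //.
  by rewrite map_polyC /= /horner_eval hornerX.
pose U : {poly {poly K}} := 'X^q - ('X^(q.-1))%:P * 'X.
have szU : size U = q.+1.
  rewrite size_polyDl size_polyXn // size_polyN mul_polyC.
  by rewrite (leq_ltn_trans (size_scale_leq _ _)) // size_polyX.
have monU : U \is monic.
  rewrite monicE lead_coefDl ?lead_coefXn // size_polyXn size_polyN mul_polyC.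
  by rewrite (leq_ltn_trans (size_scale_leq _ _)) // size_polyX.
have [Q PQ] : exists Q, P = Q \Po U.
  apply: (@translation_invariant_comp _ q U [seq c *: 'X | c <- s]) => //.
  - by rewrite map_inj_uniq // => c d /(congr1 (fun r : {poly K} => r`_1));
      rewrite !coefZ coefX !mulr1.
  - by rewrite size_map.
  - move=> _ /mapP[c cs ->]; rewrite sE in cs.
    rewrite comp_polyB comp_polyM comp_Xn_poly comp_polyX comp_polyC frXX.
    rewrite -polyC_exp exprZn (eqP cs) mulrDr -polyCM -scalerAr -exprSr prednK //.
    by rewrite /U; ring.
  - move=> _ /mapP[c cs ->]; rewrite sE in cs.
    have [chi chiE] := row_f 1 0 c (rowmx3_AGL2 q0 (oner_neq0 _) Fq1 Fq0 cs).
    (* The map X -> X + c Z is the identity on Z = 0, where [F] restricts to the nonzero [f]; so its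
       multiplier is 1. *)
    rewrite scale1r addr0 comp_polyXr => /eqP.
    rewrite -[X in X == _]scale1r -subr_eq0 -scalerBl scaler_eq0 (negPf f0) orbF.
    rewrite subr_eq0 => /eqP chi1; rewrite -chi1 scale1r in chiE.
    rewrite /P -[in RHS]chiE [RHS]mmap_rowmx3.
    rewrite [LHS](rmorph_mmap _ (comp_poly ('X + (c *: 'X)%:P))).
    apply: eq_mmap => [x|]; first by rewrite /= comp_polyC.
    apply: ord3P; rewrite /= ?comp_polyX ?comp_polyC //.
    by rewrite mul1r mul0r addr0 -polyCM mul_polyC.
have q10 : (0 < q.-1)%N by rewrite -subn1 subn_gt0.
have [chi chi0 chiE] := semi _ (swapmx3_AGL2 K q0).
apply: (@degree_line_at_infinity K p n q e f (map_poly (horner_eval 0) Q) s chi) => //.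
- rewrite -PZ0 PQ map_comp_poly /U rmorphB rmorphM /= map_polyXn map_polyX.
  by rewrite map_polyC /= /horner_eval hornerXn expr0n gtn_eqF // mul0r subr0.
- move=> b bq; have [c _ cE] := row_f 1 b 0 (rowmx3_AGL2 q0 (oner_neq0 _) Fq1 bq Fq0).
  by exists c; rewrite -cE scale1r.
- move=> d dq d0; have [c FE fE] := row_f d 0 0 (rowmx3_AGL2 q0 d0 dq Fq0 Fq0).
  rewrite addr0 in fE; rewrite fE.
  (* The dilation of X fixes the line X = 0 pointwise, and [F] does not vanish identically there;
     this makes the multiplier 1. *)
  have f210 := edge_neq0 u21 irrF e1.
  have : mmap polyC (edge K 2%:R 1) (c *: F) = mmap polyC (edge K 2%:R 1) F.
    rewrite -FE mmap_rowmx3; apply: eq_mmap => //.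
    by apply: ord3P; rewrite /= /edge /= ?mulr0 ?mul0r ?addr0.
  rewrite mmapZ mul_polyC -[X in _ = X]scale1r => /eqP.
  rewrite -subr_eq0 -scalerBl scaler_eq0 (negPf f210) orbF subr_eq0 => /eqP ->.
  by rewrite scale1r.
- exact: size_edge u01 homF.
- move=> k ke; rewrite (coef_edge u01 homF) ?leq_subr // subKn // addmC.
  rewrite -(coef_edge u10 homF) // -mmap_swapmx3 chiE mmapZ.
  by rewrite coefCM.
Qed.

(** * Dickson invariants and the two curves *)

(** Over a ring containing F_q this is the product of the u - a v for a in F_q, that is, the Dickson
    invariant L divided by v. *)
Definition frob_quot (S : comNzRingType) q (u v : S) : S := u ^+ q - u * v ^+ q.-1.

Definition dickson_L (S : comNzRingType) q (u v : S) : S := v * frob_quot q u v.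

(** A closed form of the quotient defining D, which makes sense in any commutative ring;
    [dickson_LD] ties it to the quotient. *)
Definition dickson_D (S : comNzRingType) q (u v : S) : S :=
  frob_quot q u v ^+ q.-1 + v ^+ (q * q.-1).

Lemma dickson_LE (S : comNzRingType) q (u v : S) : (0 < q)%N ->
  dickson_L q u v = u ^+ q * v - u * v ^+ q.
Proof.
move=> q0; have -> : v ^+ q = v * v ^+ q.-1 by rewrite -exprS prednK.
by rewrite /dickson_L /frob_quot; ring.
Qed.

(** Writing w for [frob_quot q u v], the product is w^q + w v^(q(q-1)); expanding w^q by Frobenius,
    the terms u^q v^(q(q-1)) cancel. *)
Lemma frob_quot_dickson_D (S : comNzRingType) q (u v : S) :
  (0 < q)%N -> frobenius_power S q ->
  frob_quot q u v * dickson_D q u v = u ^+ (q * q) - u * v ^+ (q * q).-1.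
Proof.
move=> q0 fr; rewrite /dickson_D mulrDr -exprS prednK //.
rewrite {1}/frob_quot (frobenius_powerB _ _ q0 fr) exprMn -!exprM /frob_quot.
have -> : (q * q).-1 = (q.-1 + q * q.-1)%N by case: q q0 {fr} => //= r _; nia.
by rewrite exprD [(q.-1 * q)%N]mulnC; ring.
Qed.

Lemma dickson_LD (S : comNzRingType) q (u v : S) :
  (0 < q)%N -> frobenius_power S q ->
  dickson_L q u v * dickson_D q u v = u ^+ (q * q) * v - u * v ^+ (q * q).
Proof.
move=> q0 fr; rewrite /dickson_L -mulrA frob_quot_dickson_D //.
have qq : (0 < q * q)%N by rewrite muln_gt0 q0.
have -> : v ^+ (q * q) = v * v ^+ (q * q).-1 by rewrite -exprS prednK.
by ring.
Qed.

Lemma dickson_L_linear (S : comNzRingType) q (a b c d u v : S) :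
  (0 < q)%N -> frobenius_power S q ->
  a ^+ q = a -> b ^+ q = b -> c ^+ q = c -> d ^+ q = d ->
  dickson_L q (a * u + b * v) (c * u + d * v) = (a * d - b * c) * dickson_L q u v.
Proof.
move=> q0 fr aq bq cq dq; rewrite !dickson_LE // !fr !exprMn aq bq cq dq; ring.
Qed.

(** Both L and the product L D are multiplied by the determinant of the substitution, so cancelling
    L leaves D unchanged. *)
Lemma dickson_D_linear (S : idomainType) q (a b c d u v : S) :
  (0 < q)%N -> frobenius_power S q ->
  a ^+ q = a -> b ^+ q = b -> c ^+ q = c -> d ^+ q = d ->
  a * d - b * c != 0 -> dickson_L q u v != 0 ->
  dickson_D q (a * u + b * v) (c * u + d * v) = dickson_D q u v.
Proof.
move=> q0 fr aq bq cq dq det0 L0.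
apply: (@mulfI _ (dickson_L q (a * u + b * v) (c * u + d * v))).
  by rewrite dickson_L_linear // mulf_neq0.
rewrite dickson_LD // {1}dickson_L_linear // -mulrA dickson_LD //.
have frr x y : (x + y) ^+ (q * q) = x ^+ (q * q) + y ^+ (q * q) :> S.
  by rewrite !exprM !fr.
by rewrite !frr !exprMn ![_ ^+ (q * q)]exprM !aq !bq !cq !dq; ring.
Qed.

Lemma rmorph_dickson_L (S T : comNzRingType) (f : {rmorphism S -> T}) q u v :
  f (dickson_L q u v) = dickson_L q (f u) (f v).
Proof. by rewrite /dickson_L /frob_quot rmorphM rmorphB rmorphM !rmorphXn. Qed.

Lemma rmorph_dickson_D (S T : comNzRingType) (f : {rmorphism S -> T}) q u v :
  f (dickson_D q u v) = dickson_D q (f u) (f v).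
Proof.
by rewrite /dickson_D /frob_quot rmorphD rmorphXn rmorphB rmorphM !rmorphXn.
Qed.

(** * The two invariant forms *)

Definition art_schreier (S : comNzRingType) q (x z : S) : S := x ^+ q - x * z ^+ q.-1.

(** Stated over an arbitrary commutative ring, so that the same expression serves for the form, its
    restriction to a line and its affine charts. *)
Definition form_D (S : comNzRingType) q (x y z : S) : S :=
  dickson_D q (art_schreier q x z) (art_schreier q y z) + z ^+ (q * q * q.-1).

Definition form_L (S : comNzRingType) q (x y z : S) : S :=
  dickson_L q (art_schreier q x z) (art_schreier q y z) ^+ q.-1
    + dickson_D q (art_schreier q x z) (art_schreier q y z) * z ^+ (q * q.-1).

Lemma rmorph_art_schreier (S T : comNzRingType) (f : {rmorphism S -> T}) q x z :
  f (art_schreier q x z) = art_schreier q (f x) (f z).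
Proof. by rewrite /art_schreier rmorphB rmorphM !rmorphXn. Qed.

Lemma rmorph_form_D (S T : comNzRingType) (f : {rmorphism S -> T}) q x y z :
  f (form_D q x y z) = form_D q (f x) (f y) (f z).
Proof. by rewrite /form_D rmorphD rmorph_dickson_D rmorphXn !rmorph_art_schreier. Qed.

Lemma rmorph_form_L (S T : comNzRingType) (f : {rmorphism S -> T}) q x y z :
  f (form_L q x y z) = form_L q (f x) (f y) (f z).
Proof.
rewrite /form_L rmorphD rmorphM rmorphXn rmorph_dickson_L rmorph_dickson_D rmorphXn.
by rewrite !rmorph_art_schreier.
Qed.

Lemma art_schreier_linear (S : comNzRingType) q (a b c e x y z : S) :
  (0 < q)%N -> frobenius_power S q ->
  a ^+ q = a -> b ^+ q = b -> c ^+ q = c -> e ^+ q.-1 = 1 ->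
  art_schreier q (a * x + b * y + c * z) (e * z) =
  a * art_schreier q x z + b * art_schreier q y z.
Proof.
move=> q0 fr aq bq cq e1; rewrite /art_schreier !fr !exprMn aq bq cq e1 mul1r.
have -> : z ^+ q = z * z ^+ q.-1 by rewrite -exprS prednK.
by ring.
Qed.

(** D is invariant, L occurs only through L^(q-1), which absorbs the determinant, and every explicit
    power of z has exponent divisible by q - 1. *)
Lemma form_DL_linear (S : idomainType) q (a b a' b' c c' e x y z : S) :
  (0 < q)%N -> frobenius_power S q ->
  a ^+ q = a -> b ^+ q = b -> a' ^+ q = a' -> b' ^+ q = b' ->
  c ^+ q = c -> c' ^+ q = c' -> e ^+ q.-1 = 1 -> (a * b' - b * a') ^+ q.-1 = 1 ->
  a * b' - b * a' != 0 ->
  dickson_L q (art_schreier q x z) (art_schreier q y z) != 0 ->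
  form_D q (a * x + b * y + c * z) (a' * x + b' * y + c' * z) (e * z) = form_D q x y z /\
  form_L q (a * x + b * y + c * z) (a' * x + b' * y + c' * z) (e * z) = form_L q x y z.
Proof.
move=> q0 fr aq bq aq' bq' cq cq' e1 det1 det0 L0.
have zE k : (e * z) ^+ (k * q.-1) = z ^+ (k * q.-1).
  by rewrite exprMn [in e ^+ _]mulnC exprM e1 expr1n mul1r.
rewrite /form_D /form_L !art_schreier_linear // dickson_D_linear //.
by rewrite !zE dickson_L_linear // exprMn det1 mul1r.
Qed.

Definition curve_D (K : fieldType) q : {mpoly K[3]} := form_D q 'X_0 'X_1 'X_2%:R.

Definition curve_L (K : fieldType) q : {mpoly K[3]} := form_L q 'X_0 'X_1 'X_2%:R.

Lemma mmap_curve_D (K : fieldType) (S : comNzRingType) (f : {rmorphism K -> S})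
    (h : 'I_3 -> S) q :
  mmap f h (curve_D K q) = form_D q (h 0) (h 1) (h 2%:R).
Proof. by rewrite rmorph_form_D /= !mmapX !mmap1U. Qed.

Lemma mmap_curve_L (K : fieldType) (S : comNzRingType) (f : {rmorphism K -> S})
    (h : 'I_3 -> S) q :
  mmap f h (curve_L K q) = form_L q (h 0) (h 1) (h 2%:R).
Proof. by rewrite rmorph_form_L /= !mmapX !mmap1U. Qed.

Lemma art_schreier_dhomog (K : fieldType) q (i : 'I_3) : (0 < q)%N ->
  art_schreier q 'X_i 'X_2%:R \is [in K[3], q.-homog].
Proof.
move=> q0; have hX (j : 'I_3) : 'X_j \is [in K[3], 1.-homog].
  by rewrite dhomogX /= mdeg1.
rewrite rpredB //; first by have := dhomogMn q (hX i); rewrite mul1n.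
have := dhomogM (hX i) (dhomogMn q.-1 (hX 2%:R)).
by rewrite mul1n add1n prednK.
Qed.

Lemma dickson_dhomog (K : fieldType) q (u v : {mpoly K[3]}) : (0 < q)%N ->
  u \is q.-homog -> v \is q.-homog ->
  dickson_L q u v \is (q * q.+1).-homog /\ dickson_D q u v \is (q * q * q.-1).-homog.
Proof.
move=> q0 hu hv; have hw : frob_quot q u v \is (q * q).-homog.
  rewrite rpredB //; first exact: dhomogMn.
  have -> : (q * q = q + q * q.-1)%N by rewrite -mulnS prednK.
  by apply: dhomogM => //; apply: dhomogMn.
split; first by rewrite mulnS; apply: dhomogM.
apply: rpredD; first exact: dhomogMn.
by rewrite -mulnA; apply: dhomogMn.
Qed.

Lemma curve_D_dhomog (K : fieldType) q : (0 < q)%N ->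
  curve_D K q \is (q ^ 3 - q ^ 2).-homog.
Proof.
move=> q0; have -> : (q ^ 3 - q ^ 2 = q * q * q.-1)%N by case: q q0 => // r _ /=; nia.
have [_ hD] := dickson_dhomog q0 (art_schreier_dhomog K 0 q0) (art_schreier_dhomog K 1 q0).
have hZ : 'X_2%:R \is [in K[3], 1.-homog] by rewrite dhomogX /= mdeg1.
by apply: rpredD => //; have := dhomogMn (q * q * q.-1) hZ; rewrite mul1n.
Qed.

Lemma curve_L_dhomog (K : fieldType) q : (0 < q)%N ->
  curve_L K q \is (q ^ 3 - q).-homog.
Proof.
move=> q0.
have [hL hD] := dickson_dhomog q0 (art_schreier_dhomog K 0 q0) (art_schreier_dhomog K 1 q0).
apply: rpredD.
  have -> : (q ^ 3 - q = q * q.+1 * q.-1)%N by case: q q0 {hL hD} => // r _ /=; nia.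
  exact: dhomogMn.
have -> : (q ^ 3 - q = q * q * q.-1 + 1 * (q * q.-1))%N.
  by case: q q0 {hL hD} => // r _ /=; nia.
by apply: dhomogM => //; apply: dhomogMn; rewrite dhomogX /= mdeg1.
Qed.

Lemma frob_quot_XnE (K : fieldType) q : frob_quot q ('X^q) 1 = 'X^(q * q) - 'X^q :> {poly K}.
Proof. by rewrite /frob_quot expr1n mulr1 exprM. Qed.

(** At the point (0 : 1 : 0) the form takes the value 1. Thus Z does not divide it, as
    [irreducible_chart] requires. *)
Lemma edge_curve_D (K : fieldType) q : (1 < q)%N ->
  mmap polyC (edge K 0 1) (curve_D K q) != 0.
Proof.
move=> q1; have q10 : (0 < q.-1)%N by rewrite -subn1 subn_gt0.
have q0 : (0 < q)%N by apply: ltnW.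
rewrite mmap_curve_D /edge /form_D /= /art_schreier !expr0n !gtn_eqF ?muln_gt0 ?q0 //=.
rewrite !mulr0 !subr0 expr1n addr0 /dickson_D frob_quot_XnE expr1n.
apply/eqP => /(congr1 (fun p : {poly K} => p.[0])).
rewrite !(hornerE, hornerXn) !expr0n !gtn_eqF ?muln_gt0 ?q0 //= subr0 expr0n gtn_eqF //.
by rewrite add0r; apply/eqP; rewrite oner_eq0.
Qed.

Lemma edge_curve_L (K : fieldType) q : (1 < q)%N ->
  mmap polyC (edge K 0 1) (curve_L K q) != 0.
Proof.
move=> q1; have q10 : (0 < q.-1)%N by rewrite -subn1 subn_gt0.
have q0 : (0 < q)%N by apply: ltnW.
rewrite mmap_curve_L /edge /form_L /= /art_schreier !expr0n !gtn_eqF ?muln_gt0 ?q0 //=.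
rewrite !mulr0 !subr0 expr1n addr0 /dickson_L frob_quot_XnE mul1r expf_neq0 //.
rewrite -size_poly_gt0 size_polyDl size_polyXn // size_polyN size_polyXn ltnS.
by rewrite -[ltnLHS]muln1 ltn_mul2l q0.
Qed.

(** If L vanished, [curve_L] would reduce to its second summand, a multiple of Z, and would vanish
    on Z = 0. *)
Lemma dickson_L_art_schreier_neq0 (K : fieldType) q : (1 < q)%N ->
  dickson_L q (art_schreier q 'X_0 'X_2%:R) (art_schreier q 'X_1 'X_2%:R)
    != 0 :> {mpoly K[3]}.
Proof.
move=> q1; have q10 : (0 < q.-1)%N by rewrite -subn1 subn_gt0.
have := edge_curve_L K q1; apply: contraNneq => L0; rewrite /curve_L /form_L L0 expr0n gtn_eqF //.
rewrite add0r rmorphM rmorphXn /= mmapX mmap1U /edge /= expr0n gtn_eqF ?mulr0 //.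
by rewrite muln_gt0 q10 ltnW.
Qed.

(** Both [A] and its inverse have last row (0, 0, a), so their upper left 2x2 blocks are inverse to
    each other. *)
Lemma AGL2_det_neq0 (K : fieldType) q (A : 'M[K]_3) :
  (0 < q)%N -> frobenius_power K q -> AGL2 q A ->
  A 2%:R 2%:R != 0 /\ A 0 0 * A 1 1 - A 0 1 * A 1 0 != 0.
Proof.
move=> q0 fr hA; have [_ [uA [A20 A21]]] := hA.
have [_ [_ [B20 B21]]] := AGL2_inv q0 fr hA.
have AB i j : A i 0 * invmx A 0 j + A i 1 * invmx A 1 j + A i 2%:R * invmx A 2%:R j
    = (i == j)%:R.
  by have := congr1 (fun M : 'M_3 => M i j) (mulmxV uA); rewrite !mxE sum_ord3.
have := AB 2%:R 2%:R; have := AB 0 0; have := AB 0 1; have := AB 1 0; have := AB 1 1.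
rewrite A20 A21 B20 B21 !mulr0 !mul0r !addr0 !add0r /= => E11 E10 E01 E00 E22; split.
  by apply/eqP => A22; move/eqP: E22; rewrite A22 mul0r eq_sym oner_eq0.
apply/eqP => det0; have : (A 0 0 * A 1 1 - A 0 1 * A 1 0) *
    (invmx A 0 0 * invmx A 1 1 - invmx A 0 1 * invmx A 1 0) = 1.
  transitivity ((A 0 0 * invmx A 0 0 + A 0 1 * invmx A 1 0) *
      (A 1 0 * invmx A 0 1 + A 1 1 * invmx A 1 1) -
      (A 0 0 * invmx A 0 1 + A 0 1 * invmx A 1 1) *
      (A 1 0 * invmx A 0 0 + A 1 1 * invmx A 1 0)); first by ring.
  by rewrite E00 E01 E10 E11 mulr1 mulr0 subr0.
by rewrite det0 mul0r => /esym/eqP; rewrite oner_eq0.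
Qed.

Lemma curves_invariant (K : fieldType) p n q : p \in [pchar K] -> q = (p ^ n)%N ->
  (1 < q)%N -> G_invariant (AGL2 q) (curve_D K q) /\ G_invariant (AGL2 q) (curve_L K q).
Proof.
move=> pK qE q1; have q0 : (0 < q)%N by apply: ltnW.
have frK : frobenius_power K q by rewrite qE; apply: pchar_frobenius_power.
have fr : frobenius_power {mpoly K[3]} q.
  by rewrite qE; apply: (rmorph_frobenius_power (@mpolyC 3 K)).
suff inv B : AGL2 q B -> pullback B (curve_D K q) = curve_D K q /\
    pullback B (curve_L K q) = curve_L K q.
  by split=> A /(AGL2_inv q0 frK) /inv[inv1 inv2]; exists 1;
    rewrite ?oner_neq0 // scale1r.
move=> hB; have [B22 detB] := AGL2_det_neq0 q0 frK hB; have [Bq [_ [B20 B21]]] := hB.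
have cq j k : (B j k)%:MP ^+ q = (B j k)%:MP :> {mpoly K[3]}.
  by rewrite -rmorphXn /= (eqP (Bq j k)).
have unit_pow (c : K) : in_Fq q c -> c != 0 -> (c%:MP : {mpoly K[3]}) ^+ q.-1 = 1.
  move=> /eqP cE c0; rewrite -rmorphXn /=; have -> : c ^+ q.-1 = 1; last by rewrite rmorph1.
  by apply: (mulIf c0); rewrite mul1r -exprSr prednK.
rewrite /pullback [X in X = _ /\ _]mmap_curve_D [X in _ /\ X = _]mmap_curve_L.
rewrite !tnth_mktuple !sum_ord3 B20 B21 !scale0r !add0r -!mul_mpolyC.
apply: form_DL_linear; rewrite ?cq ?unit_pow ?dickson_L_art_schreier_neq0 //.
- rewrite -!rmorphM -rmorphB unit_pow //.
  by rewrite /in_Fq (frobenius_powerB _ _ q0 frK) !exprMn !(eqP (Bq _ _)).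
- by rewrite -!rmorphM -rmorphB mpolyC_eq0.
Qed.

(** * Irreducibility *)

(* theta realizes K[r, t] inside the function field K(X/Z, Y/Z), so that h is an
   affine chart of the plane. *)
Lemma irreducible_chart (K : fieldType) d (F : {mpoly K[3]}) (h : 'I_3 -> {poly {poly K}})
    (theta : {rmorphism {poly {poly K}} -> {fraction {mpoly K[3]}}}) :
  (forall c, theta c%:P%:P = tofrac c%:MP) ->
  (forall i, tofrac 'X_2%:R * theta (h i) = tofrac 'X_i) ->
  F \is d.-homog -> (0 < d)%N -> mmap polyC (edge K 0 1) F != 0 ->
  (forall g1 g2, mmap (polyC \o polyC) h F = g1 * g2 ->
     (exists c : K, g1 = c%:P%:P) \/ (exists c : K, g2 = c%:P%:P)) ->
  irr_plane_curve d F.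
Proof.
move=> thC thX homF d0 edgeF irrF.
have F0 : F != 0 by apply: contraNneq edgeF => ->; rewrite raddf0.
split=> //; split=> //; split.
  have := mlead_supp F0 => /[dup] /msize_mdeg_lt; move=> + /(dhomogP _ _ _ homF) /= dE.
  by rewrite dE; apply: leq_trans.
have factor G H : F = G * H -> (exists c : K, mmap (polyC \o polyC) h G = c%:P%:P) ->
    (msize G <= 1)%N.
  move=> FGH [c Gc]; have [k homG] := dhomog_factor F0 homF FGH.
  (* Undoing the chart multiplies by Z^k, so a factor that is constant in the chart is c Z^k; for
     [k > 0] it would make [F] vanish on Z = 0. *)
  have GE : G = 'X_2%:R ^+ k * c%:MP.
    apply/eqP; rewrite -(tofrac_eq G) rmorphM rmorphXn /= -thC -Gc; apply/eqP.
    rewrite (rmorph_mmap _ theta) -(mmap_dhomog _ _ _ homG).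
    rewrite -[in LHS](mmap_mpoly_id G) (rmorph_mmap _ (@tofrac _)).
    by apply: eq_mmap => [x|i] /=; rewrite ?thC ?thX.
  case: k GE {homG} => [|k] GE; first by rewrite GE mul1r msizeC; case: eqP.
  case/eqP: edgeF; rewrite FGH GE !rmorphM rmorphXn /= mmapX mmap1U /edge /=.
  by rewrite expr0n !mul0r.
move=> G H FGH; have [||] := irrF (mmap (polyC \o polyC) h G) (mmap (polyC \o polyC) h H).
- by rewrite -rmorphM -FGH.
- by move=> Gc; left; apply: (factor G H).
- by move=> Hc; right; apply: (factor H G) => //; rewrite mulrC.
Qed.

Lemma chart_inverse (K : fieldType) (L : comNzRingType) (f : {rmorphism K -> L}) (r t : L) :
  exists theta : {rmorphism {poly {poly K}} -> L},
    [/\ forall c, theta c%:P%:P = f c, theta 'X%:P = r & theta 'X = t].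
Proof.
pose th1 : {rmorphism {poly K} -> L} := horner_morph (fun x => mulrC r (f x)).
pose th2 : {rmorphism {poly {poly K}} -> L} := horner_morph (fun x => mulrC t (th1 x)).
exists th2; split.
- by move=> c; rewrite /th2 /= horner_morphC /th1 /= horner_morphC.
- by rewrite /th2 /= horner_morphC /th1 /= horner_morphX.
- by rewrite /th2 /= horner_morphX.
Qed.

Lemma size_art_schreier_1 (R : idomainType) q : (1 < q)%N ->
  size (art_schreier q 'X 1 : {poly R}) = q.+1.
Proof.
by move=> q1; rewrite /art_schreier expr1n mulr1 size_polyDl size_polyXn // size_polyN size_polyX.
Qed.

(** In the chart Z = 1, with y inner and x outer, L = v w and the equation is A w^(q-1) +
    v^(q(q-1)), where w is monic in x and A = v^(q-1) + 1. At each root of A the first summand dies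
    while v is nonzero. *)
Lemma curve_L_irreducible (K : closedFieldType) p n q :
  p \in [pchar K] -> q = (p ^ n)%N -> (1 < q)%N ->
  irr_plane_curve (q ^ 3 - q)%N (curve_L K q).
Proof.
move=> pK qE q1; have q0 : (0 < q)%N by apply: ltnW.
have q10 : (0 < q.-1)%N by rewrite -subn1 subn_gt0.
have qK : q%:R = 0 :> K.
  rewrite qE natrX (GRing.pcharf0 pK) expr0n; case: n qE => // qE.
  by rewrite qE expn0 in q1.
pose f := (@tofrac _) \o @mpolyC 3 K : {rmorphism K -> {fraction {mpoly K[3]}}}.
have Z0 : tofrac ('X_2%:R : {mpoly K[3]}) != 0.
  by rewrite tofrac_eq0 -msize_poly_eq0 msizeX.
have [th [thC thY thX]] := chart_inverse f
  (tofrac 'X_1 / tofrac 'X_2%:R) (tofrac 'X_0 / tofrac 'X_2%:R).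
pose h (i : 'I_3) : {poly {poly K}} := if i == 0 then 'X else if i == 1 then 'X%:P else 1.
apply: (@irreducible_chart K _ _ h th) => //.
- by apply: ord3P; rewrite /h /= ?thX ?thY ?rmorph1 ?mulr1 // mulrC divfK.
- by apply: curve_L_dhomog.
- by rewrite subn_gt0 -[ltnLHS]expn1 ltn_exp2l.
- exact: edge_curve_L.
pose v0 : {poly K} := art_schreier q 'X 1.
pose w : {poly {poly K}} := frob_quot q (art_schreier q 'X 1) v0%:P.
pose A : {poly K} := v0 ^+ q.-1 + 1.
have -> : mmap (polyC \o polyC) h (curve_L K q) =
    A%:P * w ^+ q.-1 + (v0 ^+ (q * q.-1))%:P.
  rewrite mmap_curve_L /form_L /h /= expr1n mulr1 /dickson_L /dickson_D.
  have -> : art_schreier q 'X%:P 1 = v0%:P.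
    by rewrite -[1]/(1%:P) -(rmorph_art_schreier polyC).
  have -> : A%:P = v0%:P ^+ q.-1 + 1 by rewrite [LHS]polyCD polyC_exp.
  by rewrite -/w exprMn [in RHS]polyC_exp; ring.
have szu := size_art_schreier_1 {poly K} q1.
have szw : size w = (q * q).+1 /\ lead_coef w = 1.
  have szuq : size (art_schreier q 'X 1 ^+ q : {poly {poly K}}) = (q * q).+1.
    have := size_exp (art_schreier q 'X 1 : {poly {poly K}}) q; rewrite szu /= => E.
    rewrite -E prednK // size_poly_gt0 expf_neq0 // -size_poly_gt0 szu //.
  have small : (size (- (art_schreier q 'X 1 * v0%:P ^+ q.-1 : {poly {poly K}}))
      < size (art_schreier q 'X 1 ^+ q : {poly {poly K}}))%N.
    rewrite szuq size_polyN mulrC -rmorphXn mul_polyC.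
    rewrite (leq_ltn_trans (size_scale_leq _ _)) // szu ltnS.
    by rewrite -[ltnLHS]muln1 ltn_mul2l q0.
  rewrite /w /frob_quot size_polyDl // lead_coefDl // szuq lead_coef_exp.
  rewrite /art_schreier expr1n mulr1 lead_coefDl ?lead_coefXn ?expr1n //.
  by rewrite size_polyN size_polyX size_polyXn.
have szv0 : size v0 = q.+1 by apply: size_art_schreier_1.
have [szA A0] : size A = (q * q.-1).+1 /\ A != 0.
  have szv : size (v0 ^+ q.-1) = (q * q.-1).+1.
    have := size_exp v0 q.-1; rewrite szv0 /= => E.
    by rewrite -E prednK // size_poly_gt0 expf_neq0 // -size_poly_gt0 szv0.
  have szAE : size A = (q * q.-1).+1.
    by rewrite size_polyDl szv // size_poly1 ltnS muln_gt0 q0.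
  by split=> //; rewrite -size_poly_gt0 szAE.
have [szf lcf] : (1 < size (A%:P * w ^+ q.-1)%R)%N /\ lead_coef (A%:P * w ^+ q.-1) = A.
  rewrite mul_polyC lead_coefZ lead_coef_exp szw.2 expr1n mulr1; split=> //.
  rewrite size_scale // -[size _]prednK.
    by rewrite size_exp szw.1 /= ltnS !muln_gt0 q0.
  by rewrite size_poly_gt0 expf_neq0 // -size_poly_gt0 szw.1.
have lcF : lead_coef (A%:P * w ^+ q.-1 + (v0 ^+ (q * q.-1))%:P) = A.
  by rewrite lead_coefDl // (leq_ltn_trans (size_polyC_leq1 _)).
have /closed_rootP[eta etaP] : size A != 1%N.
  by rewrite szA eqSS -lt0n muln_gt0 q0.
have rootA xi : root A xi -> v0.[xi] ^+ q.-1 = -1.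
  by move/rootP; rewrite !(hornerE, horner_exp) => /eqP; rewrite addr_eq0 => /eqP.
have v0n xi : root A xi -> v0.[xi] != 0.
  move/rootA => E; apply/eqP => v00; move/eqP: E.
  by rewrite v00 expr0n gtn_eqF // eq_sym oppr_eq0 oner_eq0.
move=> g1 g2; apply: (@reversed_eisenstein K eta); rewrite lcF //.
  have dv0 : v0^`() = -1.
    rewrite /v0 /art_schreier expr1n mulr1 derivB derivXn derivX -mulr_natl.
    by rewrite -polyC_natr qK mul0r sub0r.
  have q1K : q.-1%:R = -1 :> K.
    by apply/eqP; rewrite -addr_eq0 -[X in _ + X]/(1%:R) -natrD addn1 prednK // qK.
  (* Both q - 1 and the derivative of [v0] equal -1 in characteristic p, so the signs cancel; as
     [v0] is nonzero at the roots of [A], these are all simple. *)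
  have -> : A^`() = v0 ^+ q.-2.
    rewrite /A derivD derivC addr0 deriv_exp dv0 -mulr_natr -polyC_natr q1K polyCN.
    by rewrite polyC1; ring.
  by rewrite rootE horner_exp expf_neq0 // v0n.
move=> xi xiA; exists (v0.[xi] ^+ (q * q.-1)).
  by rewrite expf_neq0 ?v0n.
rewrite rmorphD rmorphM /= !map_polyC /= /horner_eval (rootP xiA) mul0r add0r.
by rewrite horner_exp.
Qed.

(** The element [b] lies in F_(q^2) but not in F_q, and [c] is the difference of its conjugate and
    itself: take c^(q-1) = -1, then a root [b] of X^q - X - c. *)
Lemma Fq2_element (K : closedFieldType) q : (1 < q)%N -> frobenius_power K q ->
  exists b c : K, [/\ c != 0, b ^+ q = b + c & c ^+ q = - c].
Proof.
move=> q1 fr; have q0 : (0 < q)%N by apply: ltnW.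
have q10 : (0 < q.-1)%N by rewrite -subn1 subn_gt0.
have /closed_rootP[c] : size ('X^(q.-1) + 1%:P : {poly K}) != 1%N.
  by rewrite size_XnaddC // eqSS -lt0n.
move/rootP; rewrite !(hornerE, hornerXn) => /eqP; rewrite addr_eq0 => /eqP cq.
have c0 : c != 0.
  apply/eqP => c0; move/eqP: cq.
  by rewrite c0 expr0n gtn_eqF // eq_sym oppr_eq0 oner_eq0.
have /closed_rootP[b] : size ('X^q - ('X + c%:P) : {poly K}) != 1%N.
  rewrite size_polyDl size_polyXn ?size_polyN ?size_XaddC //.
  by rewrite eqSS -lt0n.
move/rootP; rewrite !(hornerE, hornerXn) => /eqP; rewrite subr_eq0 => /eqP bq.
by exists b, c; split=> //; rewrite -(prednK q0) exprS cq mulrN1.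
Qed.

(* For b in F_(q^2) \ F_q the polynomial u - b v becomes, up to a constant, linear
   in y once x is replaced by b^q y + t; so r = u - b v and t = x - b^q y are
   coordinates on the affine plane, and r divides D exactly once. *)
Lemma dickson_D_chart (S : comNzRingType) q (b c y t r : S) :
  (0 < q)%N -> frobenius_power S q -> b ^+ q = b + c -> c ^+ q = - c ->
  c * y = t ^+ q - t - r ->
  let u := art_schreier q ((b + c) * y + t) 1 in let v := art_schreier q y 1 in
  [/\ u = r + b * v, c * v = t + r + r ^+ q - t ^+ (q * q),
      frob_quot q u v = c * v ^+ q - r * v ^+ q.-1 + r ^+ q &
      frob_quot q u v * dickson_D q u v = r ^+ (q * q) - r * v ^+ (q * q).-1].
Proof.
move=> q0 fr bq cq cy u v.
(* As [b + c] is b^q, this says b^(q^2) = b; later it cancels the terms b v^(q^2). *)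
have bbq : (b + c) ^+ q = b by rewrite fr bq cq; ring.
have vE : v = y ^+ q - y by rewrite /v /art_schreier expr1n mulr1.
have uE : u = r + b * v.
  have rE : r = t ^+ q - t - c * y by rewrite cy; ring.
  by rewrite vE rE /u /art_schreier expr1n mulr1 fr exprMn bbq; ring.
have cvE : c * v = t + r + r ^+ q - t ^+ (q * q).
  have : (c * y) ^+ q = t ^+ (q * q) - t ^+ q - r ^+ q.
    by rewrite cy !(frobenius_powerB _ _ q0 fr) exprM.
  rewrite exprMn cq => E; rewrite vE mulrBr cy.
  by rewrite -[c * _]opprK -mulNr E; ring.
have qq0 : (0 < q * q)%N by rewrite muln_gt0 q0.
have vq : v ^+ q = v * v ^+ q.-1 by rewrite -exprS prednK.
have wE : frob_quot q u v = c * v ^+ q - r * v ^+ q.-1 + r ^+ q.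
  by rewrite /frob_quot uE fr exprMn bq vq; ring.
split=> //; rewrite frob_quot_dickson_D // {1}uE.
have bqq : b ^+ (q * q) = b by rewrite exprM bq bbq.
have -> : (r + b * v) ^+ (q * q) = r ^+ (q * q) + b * (v * v ^+ (q * q).-1).
  rewrite -exprS prednK //; have -> : (r + b * v) ^+ (q * q) = r ^+ (q * q) + (b * v) ^+ (q * q).
    by rewrite !exprM !fr.
  by rewrite exprMn bqq.
by rewrite uE; ring.
Qed.

(** Here [m] is the size of D as a polynomial in t. The equation gives D the degree q^2 (q^2 - q -
    1), positive for q >= 2. *)
Lemma size_dickson_D_gt1 q m : (1 < q)%N ->
  ((q * q * q).+1 + m).-1 = (q * q * (q * q).-1).+1 -> (1 < m)%N.
Proof. by case: q => [|[|r]] // _; nia. Qed.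

(** In the coordinates (r, t) of [dickson_D_chart], the leading coefficient of D in t is a constant
    times r, and D vanishes identically at r = 0. So D + 1 reduces to 1 at the simple root 0. *)
Lemma curve_D_irreducible (K : closedFieldType) p n q :
  p \in [pchar K] -> q = (p ^ n)%N -> (1 < q)%N ->
  irr_plane_curve (q ^ 3 - q ^ 2)%N (curve_D K q).
Proof.
move=> pK qE q1; have q0 : (0 < q)%N by apply: ltnW.
have q10 : (0 < q.-1)%N by rewrite -subn1 subn_gt0.
have frK : frobenius_power K q by rewrite qE; apply: pchar_frobenius_power.
have frXX : frobenius_power {poly {poly K}} q.
  by rewrite qE; apply: pchar_frobenius_power; do 2!apply: (rmorph_pchar polyC).
have [b [c [c0 bq cq]]] := Fq2_element q1 frK.
pose L := {fraction {mpoly K[3]}}.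
pose f := (@tofrac _) \o @mpolyC 3 K : {rmorphism K -> L}.
have Z0 : tofrac ('X_2%:R : {mpoly K[3]}) != 0.
  by rewrite tofrac_eq0 -msize_poly_eq0 msizeX.
pose x' : L := tofrac 'X_0 / tofrac 'X_2%:R; pose y' : L := tofrac 'X_1 / tofrac 'X_2%:R.
pose t' := x' - f (b + c) * y'; pose r' := t' ^+ q - t' - f c * y'.
have [th [thC thr tht]] := chart_inverse f r' t'.
pose r : {poly {poly K}} := 'X%:P; pose t : {poly {poly K}} := 'X.
pose k (a : K) : {poly {poly K}} := a%:P%:P.
pose y := k c^-1 * (t ^+ q - t - r).
pose x := k (b + c) * y + t.
pose h (i : 'I_3) : {poly {poly K}} := if i == 0 then x else if i == 1 then y else 1.
have thy : th y = y'.
  rewrite /y rmorphM !rmorphB rmorphXn /= thC thr tht.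
  have -> : t' ^+ q - t' - r' = f c * y' by rewrite /r'; ring.
  have fc : f c^-1 * f c = 1 by rewrite -rmorphM mulVf // rmorph1.
  by rewrite mulrA fc mul1r.
apply: (@irreducible_chart K _ _ h th) => //.
- have thx : th x = x' by rewrite /x rmorphD rmorphM /= thC tht thy /t' addrC subrK.
  by apply: ord3P; rewrite /h /= ?thx ?thy ?rmorph1 ?mulr1 // mulrC divfK.
- by apply: curve_D_dhomog.
- by rewrite subn_gt0 ltn_exp2l.
- exact: edge_curve_D.
rewrite mmap_curve_D /form_D /h /= expr1n.
have kq a d : a ^+ q = d -> k a ^+ q = k d by move=> <-; rewrite /k !polyC_exp.
have cy : k c * y = t ^+ q - t - r by rewrite /y mulrA -!polyCM mulfV // mul1r.
have kD a d : k (a + d) = k a + k d by rewrite /k !polyCD.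
have [] := dickson_D_chart q0 frXX (b := k b) (c := k c) _ _ cy.
- by rewrite (kq _ _ bq) kD.
- by rewrite (kq _ _ cq) /k !polyCN.
rewrite -kD -/x; set u := art_schreier q x 1; set v := art_schreier q y 1.
set w := frob_quot q u v; set D := dickson_D q u v => _ cv wE wD.
have N0 : (0 < (q * q).-1)%N by rewrite -subn1 subn_gt0 (leq_trans q1) // leq_pmulr.
have [szv [lam lam0 lcv]] : size v = (q * q).+1 /\
    exists2 lam : K, lam != 0 & lead_coef v = lam%:P.
  have cvE : c%:P *: v = - ('X^(q * q) - ('X + ('X + 'X^q)%:P)).
    by rewrite -mul_polyC -/(k c) cv /r /t rmorphD rmorphXn /=; ring.
  have small : (size (- ('X + ('X + 'X^q)%:P) : {poly {poly K}})
      < size ('X^(q * q) : {poly {poly K}}))%N.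
    rewrite size_polyN size_XaddC size_polyXn ltnS.
    by rewrite -[ltnLHS]muln1; apply: ltn_mul.
  have szv : size v = (q * q).+1.
    by rewrite -(size_scale v (a := c%:P)) ?polyC_eq0 // cvE size_polyN
      (size_polyDl small) size_polyXn.
  split=> //; exists (- c^-1); first by rewrite oppr_eq0 invr_eq0.
  have := congr1 lead_coef cvE; rewrite lead_coefZ lead_coefN (lead_coefDl small) lead_coefXn.
  move=> E; apply: (@mulfI _ c%:P); first by rewrite polyC_eq0.
  by rewrite E -polyCM mulrN mulfV // polyCN.
have szvn m : size (v ^+ m) = (q * q * m).+1.
  have := size_exp v m; rewrite szv /= => E.
  by rewrite -E prednK // size_poly_gt0 expf_neq0 // -size_poly_gt0 szv.
have lcvn m : lead_coef (v ^+ m) = (lam ^+ m)%:P by rewrite lead_coef_exp lcv polyC_exp.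
have [szw lcw] : size w = (q * q * q).+1 /\ lead_coef w = (c * lam ^+ q)%:P.
  have sz1 : size (k c * v ^+ q) = (q * q * q).+1.
    by rewrite mul_polyC size_scale ?polyC_eq0 // szvn.
  have small : (size (r ^+ q - r * v ^+ q.-1)%R < size (k c * v ^+ q)%R)%N.
    rewrite sz1 (leq_ltn_trans (size_polyD _ _)) // gtn_max size_polyN.
    rewrite -polyC_exp (leq_ltn_trans (size_polyC_leq1 _)) /=; last first.
      by rewrite ltnS !muln_gt0 q0.
    rewrite mul_polyC (leq_ltn_trans (size_scale_leq _ _)) // szvn ltnS.
    by rewrite ltn_mul2l muln_gt0 q0 /= prednK.
  have -> : w = k c * v ^+ q + (r ^+ q - r * v ^+ q.-1) by rewrite wE; ring.
  by rewrite size_polyDl // lead_coefDl // sz1 mul_polyC lead_coefZ lcvn -polyCM.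
have clam0 : c * lam ^+ q != 0 by rewrite mulf_neq0 // expf_neq0.
have [szM lcM] : size (w * D) = (q * q * (q * q).-1).+1 /\
    lead_coef (w * D) = - (lam ^+ (q * q).-1 *: 'X).
  have sz1 : size (- (r * v ^+ (q * q).-1)) = (q * q * (q * q).-1).+1.
    by rewrite size_polyN mul_polyC size_scale ?polyX_eq0 // szvn.
  have small : (size (r ^+ (q * q))%R < size (- (r * v ^+ (q * q).-1))%R)%N.
    rewrite sz1 -polyC_exp (leq_ltn_trans (size_polyC_leq1 _)) //.
    by rewrite ltnS !muln_gt0 q0.
  rewrite wD addrC size_polyDl // lead_coefDl // sz1 lead_coefN mul_polyC lead_coefZ lcvn.
  by rewrite mulrC mul_polyC.
have w0 : w != 0 by rewrite -size_poly_gt0 szw.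
have D0 : D != 0 by apply/eqP => D0; move: szM; rewrite D0 mulr0 size_poly0.
have szD : (1 < size D)%N.
  by apply: (size_dickson_D_gt1 q1); rewrite -szM size_mul // szw.
(* The quotient of the leading coefficients of [w * D] and [w], without its factor r. *)
pose kap := - (lam ^+ (q * q).-1 / (c * lam ^+ q)).
have kap0 : kap != 0 by rewrite oppr_eq0 mulf_neq0 ?invr_eq0 // expf_neq0.
have lcD : lead_coef D = kap *: 'X.
  apply: (@mulfI _ (c * lam ^+ q)%:P); first by rewrite polyC_eq0.
  rewrite -lcw -lead_coefM lcM lcw mul_polyC scalerA /kap mulrN mulrC divfK //.
  by rewrite scaleNr.
have lcF : lead_coef (D + 1) = kap *: 'X by rewrite lead_coefDl // size_poly1.
move=> g1 g2; apply: (@reversed_eisenstein K 0); rewrite lcF.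
- by rewrite rootE !hornerE.
- by rewrite derivZ derivX rootE !hornerE.
move=> xi; rewrite rootZ // rootX => /eqP ->; exists 1; first exact: oner_neq0.
have rZ m : (0 < m)%N -> map_poly (horner_eval 0) (r ^+ m) = 0.
  move=> m0; rewrite rmorphXn /= /r map_polyC /= /horner_eval hornerX expr0n.
  by rewrite gtn_eqF.
(* At r = 0 the product [w * D] vanishes, but [w] does not, having a nonzero constant as leading
   coefficient; hence [D] does. *)
have : map_poly (horner_eval 0) w * map_poly (horner_eval 0) D = 0.
  have r0 : map_poly (horner_eval 0) r = 0 by rewrite -[r]expr1 rZ.
  rewrite -rmorphM /= wD rmorphB /= rZ ?muln_gt0 ?q0 // (rmorphM _ r) /= r0 mul0r.
  by rewrite subrr.
move/eqP; rewrite mulf_eq0 => /orP[/eqP wZ|/eqP DZ]; last first.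
  by rewrite rmorphD rmorph1 /= DZ add0r.
have := congr1 (fun P : {poly K} => P`_(size w).-1) wZ; rewrite coef_map -lead_coefE lcw.
by rewrite /= /horner_eval hornerC coef0 => /eqP; rewrite (negPf clam0).
Qed.

(** * The two smallest degrees and their difference *)

Theorem mainTheorem2 (K : closedFieldType) (p n : nat) (q : nat) :
  prime p -> p \in [pchar K] -> (0 < n)%N -> q = (p ^ n)%N ->
  (* K is an algebraic closure of F_q: algebraically closed and algebraic
     over F_q, i.e. every element lies in some F_(q^m) *)
  (forall x : K, exists2 m : nat, (0 < m)%N & x ^+ (q ^ m) = x) ->
  is_epsilon (AGL2 (K := K) q) (q ^ 2 - q)%N.
Proof.
move=> p_prime pK n0 qE _.
have q1 : (1 < q)%N by rewrite qE -(exp1n n) ltn_exp2r // prime_gt1.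
have [invD invL] := curves_invariant pK qE q1.
have degree e := AGL2_invariant_degree (e := e) pK qE q1.
exists (q ^ 3 - q ^ 2)%N, (q ^ 3 - q)%N.
have gap : [/\ (1 < q ^ 3 - q ^ 2)%N, (q ^ 3 - q ^ 2 < q ^ 3 - q)%N &
    (q ^ 2 - q = q ^ 3 - q - (q ^ 3 - q ^ 2))%N].
  by case: q q1 {qE invD invL degree} => [|[|r]] // _; split; nia.
case: gap => d1 dd' epsE; split; last split=> //; last split; last split=> //.
- split=> //; split; first by exists (curve_D K q); split=> //; apply: curve_D_irreducible qE q1.
  by move=> e e1 /degree-/(_ e1)[->|/(leq_trans (ltnW dd'))].
- by exists (curve_L K q); split=> //; apply: curve_L_irreducible qE q1.
move=> e de /degree-/(_ (ltn_trans d1 de))[eE|//].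
by rewrite eE ltnn in de.
Qed.
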